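(* Let $(W,S,L)$ be a standard finite Coxeter system with generic Hecke algebra $\mathcal H$ over $\mathcal Z=\mathbb Z[t,t^{-1}]$, and let $(\mathscr A(\mathscr L),\mathscr E^\flat(\mathscr L))$ be the exact category of left $\mathcal H$-modules defined in the context. For any $J\subseteq S$, $$\mathrm{Ext}^1_{\mathscr E^\flat(\mathscr L)}(\mathcal Hx_J,S(\omega))=0\quad\text{for all }\omega\in\Omega.$$
   Context: ''Finite'' means finitely generated; modules are left modules. $(W,S,L)$ is a standard finite Coxeter system: there are a simple algebraic group $\mathbf G$ over an algebraically closed field of characteristic $p>0$ and a Frobenius map $F$ (an endomorphism some power of which is a standard Frobenius map), inducing a permutation $\rho$ of the Dynkin diagram, such that, with $(\mathbf W,\mathbf S)$ the Weyl group of $\mathbf G$ relative to an $F$-stable maximal torus in an $F$-stable Borel subgroup, $W=\mathbf W^F$, $S$ is the set of longest elements of the parabolic subgroups of $\mathbf W$ attached to the $\rho$-orbits on $\mathbf S$, and $L(w)$ is the length of $w\in W$ in $\mathbf W$; moreover $|S|\ge2$. $\mathcal H$ is the $\mathcal Z$-algebra with basis $\{T_w\}_{w\in W}$ and relations $T_sT_w=T_{sw}$ if $sw>w$, $T_sT_w=t^{2L(s)}T_{sw}+(t^{2L(s)}-1)T_w$ if $sw<w$ ($s\in S$). Put $\widetilde T_w=t^{-L(w)}T_w$. The bar involution is the ring involution with $t\mapsto t^{-1}$, $T_w\mapsto (T_{w^{-1}})^{-1}$; $\mathsf c_w=\sum_{y\le w}p_{y,w}\widetilde T_y$ is the unique bar-invariant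 element with $p_{w,w}=1$, $p_{y,w}\in t^{-1}\mathbb Z[t^{-1}]$ for $y<w$. The preorder $\le_L$ on $W$ is the reflexive-transitive closure of: $y\le_L w$ if $\mathsf c_y$ occurs with nonzero coefficient in $\mathsf c_s\mathsf c_w$ for some $s\in S$; $x\le_R y$ iff $x^{-1}\le_L y^{-1}$; $\le_{LR}$ is generated by $\le_L,\le_R$. $\Omega$ is the set of left cells (equivalence classes of $\le_L$), with the induced preorder $\le_{LR}$. For $\omega\in\Omega$, $w\in\omega$, $S(\omega)=\sum_{y\le_L w}\mathcal Z\mathsf c_y\big/\sum_{y<_L w}\mathcal Z\mathsf c_y$. $x_J=\sum_{w\in\langle J\rangle}T_w$. Height filtration. Let $K=\mathbb Q(t)$; $\mathcal H_K$ is semisimple. Fix a negative-valued function $\mathfrak h:\Omega\to\mathbb Z$ compatible with $\le_{LR}$: $\omega<_{LR}\omega'\Rightarrow\mathfrak h(\omega)<\mathfrak h(\omega')$, $\omega\sim_{LR}\omega'\Rightarrow\mathfrak h(\omega)=\mathfrak h(\omega')$. An irreducible $\mathcal H_K$-module has height $\mathfrak h(\omega)$ if it occurs in $S(\omega)_K$ (well defined). For a finite $\mathcal Z$-torsion-free left $\mathcal H$-module $M$ and $h\in\mathbb Z$, $M_h$ is the intersection of $M$ with the sum of the irreducible submodules of $M_K$ of height $<-h$. Exact category. $\mathscr A(\mathscr L)$ is the full subcategory of such $M$ for which every $M_{h-1}/M_h$ is isomorphic to a finite direct sum of left-cell modules $S(\omega)$ with $\mathfrak h(\omega)=-h$ (it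 contains all $\mathcal Hx_J$ and $S(\omega)$). $\mathscr E(\mathscr L)$ consists of the short exact sequences $0\to M\to N\to P\to0$ with terms in $\mathscr A(\mathscr L)$ such that $0\to M_{h-1}/M_h\to N_{h-1}/N_h\to P_{h-1}/P_h\to0$ is split exact for every $h$. For a left $\mathcal H$-module $V$ and $I\subseteq S$, $V^{\mathcal H_I}=\{v\in V:T_sv=t^{2L(s)}v\ \forall s\in I\}$. $\mathscr E^\flat(\mathscr L)$ consists of those sequences in $\mathscr E(\mathscr L)$ for which $0\to(M_h)^{\mathcal H_I}\to(N_h)^{\mathcal H_I}\to(P_h)^{\mathcal H_I}\to0$ is exact for every $h\in\mathbb Z$ and $I\subseteq S$. $(\mathscr A(\mathscr L),\mathscr E^\flat(\mathscr L))$ is a Quillen exact category, and $\mathrm{Ext}^1_{\mathscr E^\flat(\mathscr L)}(Y,Z)$ is the group of equivalence classes of sequences $0\to Z\to E\to Y\to0$ in $\mathscr E^\flat(\mathscr L)$. *)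

(* Defs.v *)
From HB Require Import structures.
From mathcomp Require Import all_boot all_order all_fingroup all_algebra.
From mathcomp Require Import generic_quotient.
From mathcomp Require Import boolp.
From mathcomp Require Import ring.
From mathcomp Require mpoly.

Set Implicit Arguments.
Unset Strict Implicit.
Unset Printing Implicit Defensive.

Import GRing.Theory.

Local Open Scope ring_scope.
Local Open Scope quotient_scope.

(** Z[t, t^-1] is realised as the subring of Q(t) = Frac(Z[t]) of the fractions
    with denominator a power of t. *)

Definition ratfun := {fraction {poly int}}.

Definition ratfunX : ratfun := tofrac 'X.

Definition laurent_pred : {pred ratfun} :=
  fun x => `[< exists (P : {poly int}) (n : nat), x * ratfunX ^+ n = tofrac P >].

Lemma laurent_predP (x : ratfun) :
  reflect (exists (P : {poly int}) (n : nat), x * ratfunX ^+ n = tofrac P)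
          (x \in laurent_pred).
Proof. exact: asboolP. Qed.

Lemma laurent_closed : subring_closed laurent_pred.
Proof.
split=> [|x y /laurent_predP [P [n Px]] /laurent_predP [Q [m Qy]]
         |x y /laurent_predP [P [n Px]] /laurent_predP [Q [m Qy]]];
  apply/laurent_predP.
- by exists 1, 0; rewrite expr0 mulr1 tofrac1.
- exists (P * 'X^m - Q * 'X^n), (n + m).
  rewrite tofracB !tofracM -Px -Qy !tofracXn -/ratfunX exprD mulrBl.
  by rewrite !mulrA -!mulrA [ratfunX ^+ m * _]mulrC.
- by exists (P * Q), (n + m); rewrite tofracM -Px -Qy exprD mulrACA.
Qed.

HB.instance Definition _ :=
  GRing.isSubringClosed.Build ratfun laurent_pred laurent_closed.

Record laurent := Laurent {
  laurent_val :> ratfun;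
  laurent_valP : laurent_val \in laurent_pred }.

HB.instance Definition _ := [isSub for laurent_val].
HB.instance Definition _ := [Choice of laurent by <:].
HB.instance Definition _ := [SubChoice_isSubComNzRing of laurent by <:].

Definition laurent_unit : {pred laurent} :=
  fun x => (val x != 0) && ((val x)^-1 \in laurent_pred).

Definition laurent_inv (x : laurent) : laurent := insubd x (val x)^-1.

Lemma laurent_mulVx : {in laurent_unit, left_inverse 1 laurent_inv *%R}.
Proof.
move=> x /andP [x0 xV]; apply: val_inj.
by rewrite rmorphM rmorph1 /= insubdK // mulVf.
Qed.

Lemma laurent_unitPl (x y : laurent) : y * x = 1 -> laurent_unit x.
Proof.
move/(congr1 val); rewrite rmorphM rmorph1 /= => yx; apply/andP.
have x0 : val x != 0.
  by apply/eqP => x0; move/eqP: yx; rewrite x0 mulr0 eq_sym oner_eq0.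
split=> //; suff -> : (val x)^-1 = val y by exact: valP.
by apply: (mulIf x0); rewrite mulVf.
Qed.

Lemma laurent_inv_out : {in [predC laurent_unit], laurent_inv =1 id}.
Proof.
move=> x; rewrite inE /= /laurent_unit unfold_in negb_and negbK => /orP [/eqP x0|xV].
  by apply: val_inj; rewrite /laurent_inv x0 invr0 insubdK ?x0 // rpred0.
by rewrite /laurent_inv /insubd insubN.
Qed.

HB.instance Definition _ := GRing.ComNzRing_hasMulInverse.Build laurent
  laurent_mulVx laurent_unitPl laurent_inv_out.

Lemma laurent_domain : GRing.integral_domain_axiom laurent.
Proof.
move=> x y /(congr1 val); rewrite rmorphM rmorph0 => /eqP.
by rewrite mulf_eq0 => /orP [] /eqP h; apply/orP; [left|right]; apply/eqP;
  apply: val_inj; rewrite h rmorph0.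
Qed.

HB.instance Definition _ :=
  GRing.ComUnitRing_isIntegral.Build laurent laurent_domain.

Lemma laurentX_subproof : ratfunX \in laurent_pred.
Proof. by apply/laurent_predP; exists 'X, 0; rewrite expr0 mulr1. Qed.

Definition laurentX : laurent := Laurent laurentX_subproof.

Lemma laurentX_unit : laurentX \is a GRing.unit.
Proof.
rewrite unfold_in /= /laurent_unit /=.
have X0 : ratfunX != 0 by rewrite /ratfunX tofrac_eq0 polyX_eq0.
by rewrite X0; apply/laurent_predP; exists 1, 1; rewrite expr1 mulVf // tofrac1.
Qed.

(** p lies in t^-1 Z[t^-1] *)
Definition negative_laurent (p : laurent) : Prop :=
  exists P : {poly int}, p = laurentX^-1 * (map_poly intr P).[laurentX^-1].

Section Submodules.
Variables (R : pzRingType) (M : lmodType R).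

Record submod := Submod {
  submod_pred :> {pred M};
  submod_closedP : subsemimod_closed submod_pred }.

HB.instance Definition _ (U : submod) :=
  GRing.isSubmodClosed.Build R M (submod_pred U) (submod_closedP U).

Variable U : submod.

Record submodType := SubmodElt {
  submod_val :> M;
  submod_valP : submod_val \in submod_pred U }.

HB.instance Definition _ := [isSub for submod_val].
HB.instance Definition _ := [Choice of submodType by <:].
HB.instance Definition _ := [SubChoice_isSubLmodule of submodType by <:].

Definition quotmod := Quotient.quot (submod_pred U : zmodClosed M).
HB.instance Definition _ := GRing.Zmodule.on quotmod.
HB.instance Definition _ := EqQuotient.on quotmod.

Definition quotmod_proj (x : M) : quotmod := \pi_quotmod x.

Definition quotmod_scale (a : R) (x : quotmod) : quotmod :=
  quotmod_proj (a *: repr x).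

Lemma quotmod_eq (x y : M) : (quotmod_proj x == quotmod_proj y) = (x - y \in U).
Proof. by rewrite [RHS]Quotient.idealrBE. Qed.

Lemma quotmod_projD : {morph quotmod_proj : x y / x + y}.
Proof. exact: Quotient.pi_add. Qed.

Lemma quotmod_projZ a x : quotmod_proj (a *: x) = quotmod_scale a (quotmod_proj x).
Proof.
apply/eqP; rewrite quotmod_eq -scalerBr rpredZ // -quotmod_eq.
by rewrite /quotmod_proj reprK.
Qed.

Lemma quotmodW (P : quotmod -> Prop) :
  (forall x, P (quotmod_proj x)) -> forall x, P x.
Proof. by move=> h x; rewrite -[x]reprK; apply: h. Qed.

Fact quotmod_scaleA a b x :
  quotmod_scale a (quotmod_scale b x) = quotmod_scale (a * b) x.
Proof. by elim/quotmodW: x => x; rewrite -!quotmod_projZ scalerA. Qed.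
Fact quotmod_scale1 : left_id 1 quotmod_scale.
Proof. by elim/quotmodW => x; rewrite -quotmod_projZ scale1r. Qed.
Fact quotmod_scaleDr : right_distributive quotmod_scale +%R.
Proof.
move=> a; elim/quotmodW => x; elim/quotmodW => y.
by rewrite -quotmod_projD -!quotmod_projZ -quotmod_projD scalerDr.
Qed.
Fact quotmod_scaleDl x : {morph quotmod_scale^~ x : a b / a + b}.
Proof.
move=> a b; elim/quotmodW: x => x.
by rewrite -!quotmod_projZ -quotmod_projD scalerDl.
Qed.

HB.instance Definition _ := GRing.Zmodule_isLmodule.Build R quotmod
  quotmod_scaleA quotmod_scale1 quotmod_scaleDr quotmod_scaleDl.

End Submodules.

Section Subquotient.
Variables (R : pzRingType) (M : lmodType R).

Lemma preim_closed (N : lmodType R) (f : {linear N -> M}) (V : submod M) :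
  subsemimod_closed (fun x : N => f x \in V).
Proof.
split=> [|a x]; first split=> [|x y].
- by change (f 0 \in V); rewrite raddf0 rpred0.
- by change (f x \in V -> f y \in V -> f (x + y) \in V); rewrite raddfD; apply: rpredD.
- by change (f x \in V -> f (a *: x) \in V); rewrite linearZ; apply: rpredZ.
Qed.

Definition preim_submod (N : lmodType R) (f : {linear N -> M}) (V : submod M) :
  submod N := Submod (preim_closed f V).

(** U / V when V is contained in U; in general U / (U \cap V) *)
Definition subquot (U V : submod M) : lmodType R :=
  quotmod (preim_submod (val : {linear submodType U -> M}) V).

Definition subquot_proj (U V : submod M) : submodType U -> subquot U V :=
  @quotmod_proj _ _ _.

Definition sum_pred (P : submod M -> Prop) : {pred M} :=
  fun x => `[< forall V : submod M,
    (forall U : submod M, P U -> {subset U <= V}) -> x \in V >].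

Lemma sum_closed P : subsemimod_closed (sum_pred P).
Proof.
split=> [|a x]; first split=> [|x y].
- by apply/asboolP => V _; apply: rpred0.
- by move=> /asboolP hx /asboolP hy; apply/asboolP => V PV;
    apply: rpredD; [apply: hx | apply: hy].
- by move=> /asboolP hx; apply/asboolP => V PV; apply: rpredZ; apply: hx.
Qed.

Definition submod_sum (P : submod M -> Prop) : submod M := Submod (sum_closed P).

Definition irreducible : Prop :=
  (exists x : M, x <> 0) /\
  forall U : submod M, (forall x, x \in U -> x = 0) \/ (forall x, x \in U).

Definition occurs_in (E V : lmodType R) : Prop :=
  exists f : {linear E -> V}, injective f.

Definition finitely_generated : Prop :=
  exists (n : nat) (g : 'I_n -> M), forall x, exists a : 'I_n -> R,
    x = \sum_(i < n) a i *: g i.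

(** M is isomorphic to the direct sum of the A i: the maps [inc i] are the
    coproduct injections. *)
Definition is_direct_sum (n : nat) (A : 'I_n -> lmodType R) : Prop :=
  exists inc : forall i, {linear A i -> M},
    bijective (fun x : (forall i, A i) => \sum_(i < n) inc i (x i)).

End Subquotient.

Arguments irreducible {R} M.
Arguments finitely_generated {R} M.
Arguments is_direct_sum {R} M [n] A.

(** Exactness of 0 -> A -> B -> C -> 0 for subsets A, B, C of M, N, P and the
    restrictions of f and g. *)
Definition exact_on (M N P : Type) (zero : P) (f : M -> N) (g : N -> P)
    (A : M -> Prop) (B : N -> Prop) (C : P -> Prop) : Prop :=
  [/\ forall x, A x -> B (f x),
      forall y, B y -> C (g y),
      forall x x', A x -> A x' -> f x = f x' -> x = x',
      forall y, B y -> (g y = zero <-> exists2 x, A x & f x = y)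
    & forall z, C z -> exists2 y, B y & g y = z].

Definition short_exact (R : pzRingType) (M N P : lmodType R)
    (f : {linear M -> N}) (g : {linear N -> P}) : Prop :=
  exact_on 0 f g (fun=> True) (fun=> True) (fun=> True).

Definition split_exact (R : pzRingType) (M N P : lmodType R)
    (f : {linear M -> N}) (g : {linear N -> P}) : Prop :=
  short_exact f g /\ exists s : {linear P -> N}, forall z, g (s z) = z.

(** For a Z-algebra H over a domain Z with fraction field K and an H-module M,
    [locmod M] is the localisation of M at the nonzero elements of Z, that is
    K \otimes_Z M, and [locring H] is the ring K \otimes_Z H. *)

Section Localisation.
Variables (Z : idomainType) (H : algType Z).

Record denom := Denom { denom_val : Z; denom_neq0 : denom_val != 0 }.
HB.instance Definition _ := [isSub for denom_val].
HB.instance Definition _ := [Choice of denom by <:].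

Definition denom1 : denom := Denom (oner_neq0 Z).
Lemma denomM_subproof (a b : denom) : denom_val a * denom_val b != 0.
Proof. by rewrite mulf_neq0 ?denom_neq0. Qed.
Definition denomM (a b : denom) := Denom (denomM_subproof a b).

Local Notation dv := denom_val.

Definition regmod : lmodType H := H^o.

Section Module.
Variable M : lmodType H.

Local Notation "a *! m" := ((a : Z)%:A *: m : M) (at level 40).

Lemma zscaleA (a b : Z) (m : M) : a *! (b *! m) = (a * b) *! m.
Proof. by rewrite scalerA mulr_algl scalerA. Qed.
Lemma zscaleC (a b : Z) (m : M) : a *! (b *! m) = b *! (a *! m).
Proof. by rewrite !zscaleA mulrC. Qed.
Lemma zscaleH (a : Z) (h : H) (m : M) : a *! (h *: m) = h *: (a *! m).
Proof. by rewrite !scalerA mulr_algl mulr_algr. Qed.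

(** m/a = m'/b when s (b m - a m') = 0 for some nonzero s in Z *)
Definition loc_rel (x y : M * denom) : bool :=
  `[< exists s : denom, dv s *! (dv y.2 *! x.1) = dv s *! (dv x.2 *! y.1) >].

Lemma loc_rel_refl : reflexive loc_rel.
Proof. by move=> x; apply/asboolP; exists denom1. Qed.
Lemma loc_rel_sym : symmetric loc_rel.
Proof. by move=> x y; apply/asboolP/asboolP => -[s e]; exists s. Qed.
Lemma loc_rel_trans : transitive loc_rel.
Proof.
move=> [y b] [x a] [z c] /asboolP [/= s e] /asboolP [/= s' e']; apply/asboolP.
exists (denomM (denomM s s') b) => /=.
move: e e'; rewrite !zscaleA => e e'.
transitivity ((dv s' * dv c) *! ((dv s * dv b) *! x)).
  by rewrite zscaleA; congr (_%:A *: _); ring.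
rewrite e zscaleA; transitivity ((dv s * dv a) *! ((dv s' * dv c) *! y)).
  by rewrite zscaleA; congr (_%:A *: _); ring.
by rewrite e' zscaleA; congr (_%:A *: _); ring.
Qed.

Canonical loc_equiv := EquivRel loc_rel loc_rel_refl loc_rel_sym loc_rel_trans.

Definition locmod := {eq_quot loc_rel}.
HB.instance Definition _ : EqQuotient _ loc_rel locmod := EqQuotient.on locmod.
HB.instance Definition _ := Choice.on locmod.

Definition locfrac (m : M) (a : denom) : locmod := \pi_locmod (m, a).

Lemma locfracP (m m' : M) (a b : denom) :
  (locfrac m a = locfrac m' b) <->
  exists s : denom, dv s *! (dv b *! m) = dv s *! (dv a *! m').
Proof.
split=> [/eqmodP /asboolP //|h].
by apply/eqmodP; apply/asboolP.
Qed.

Lemma locfrac_ind (P : locmod -> Prop) :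
  (forall m a, P (locfrac m a)) -> forall x, P x.
Proof. by move=> h x; rewrite -[x]reprK; case: (repr x). Qed.

Lemma locfrac_repr m a : exists s : denom,
  dv s *! (dv a *! (repr (locfrac m a)).1) = dv s *! (dv (repr (locfrac m a)).2 *! m).
Proof. by apply/locfracP; rewrite /locfrac -surjective_pairing reprK. Qed.

Definition locadd (x y : locmod) : locmod :=
  locfrac (dv (repr y).2 *! (repr x).1 + dv (repr x).2 *! (repr y).1)
          (denomM (repr x).2 (repr y).2).

Lemma locaddE m m' a b : locadd (locfrac m a) (locfrac m' b) =
  locfrac (dv b *! m + dv a *! m') (denomM a b).
Proof.
have [s e] := locfrac_repr m a; have [s' e'] := locfrac_repr m' b.
apply/locfracP; exists (denomM s s'); move: e e' => /=.
case: (repr _) => x c /=; case: (repr _) => y d /=.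
rewrite !scalerDr !zscaleA => e e'.
congr (_ + _).
- transitivity ((dv s' * dv b * dv d) *! ((dv s * dv a) *! x)).
    by rewrite zscaleA; congr (_%:A *: _); ring.
  by rewrite e zscaleA; congr (_%:A *: _); ring.
- transitivity ((dv s * dv a * dv c) *! ((dv s' * dv b) *! y)).
    by rewrite zscaleA; congr (_%:A *: _); ring.
  by rewrite e' zscaleA; congr (_%:A *: _); ring.
Qed.

Definition locopp (x : locmod) : locmod := locfrac (- (repr x).1) (repr x).2.

Lemma locoppE m a : locopp (locfrac m a) = locfrac (- m) a.
Proof.
have [s e] := locfrac_repr m a; apply/locfracP; exists s; move: e.
by case: (repr _) => x c /=; rewrite !scalerN => ->.
Qed.

Lemma locfrac_eq m m' a b : dv b *! m = dv a *! m' -> locfrac m a = locfrac m' b.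
Proof. by move=> e; apply/locfracP; exists denom1; rewrite e. Qed.

Fact locaddA : associative locadd.
Proof.
move=> x y z; elim/locfrac_ind: x => x a; elim/locfrac_ind: y => y b.
elim/locfrac_ind: z => z c; rewrite !locaddE; apply: locfrac_eq => /=.
rewrite !scalerDr !zscaleA addrA.
by congr (_ + _ + _); congr (_%:A *: _); ring.
Qed.
Fact locaddC : commutative locadd.
Proof.
move=> x y; elim/locfrac_ind: x => x a; elim/locfrac_ind: y => y b.
rewrite !locaddE; apply: locfrac_eq => /=; rewrite addrC !scalerDr !zscaleA.
by congr (_ + _); congr (_%:A *: _); ring.
Qed.
Fact locadd0 : left_id (locfrac 0 denom1) locadd.
Proof.
move=> x; elim/locfrac_ind: x => x a; rewrite !locaddE; apply: locfrac_eq => /=.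
by rewrite scaler0 add0r zscaleA mul1r mulr1.
Qed.
Fact locaddN : left_inverse (locfrac 0 denom1) locopp locadd.
Proof.
move=> x; elim/locfrac_ind: x => x a; rewrite locoppE locaddE.
by apply: locfrac_eq => /=; rewrite scalerN addNr !scaler0.
Qed.

HB.instance Definition _ :=
  GRing.isZmodule.Build locmod locaddA locaddC locadd0 locaddN.

End Module.

Lemma locfracD (M : lmodType H) (m m' : M) a b : locfrac m a + locfrac m' b =
  locfrac ((dv b)%:A *: m + (dv a)%:A *: m') (denomM a b).
Proof. exact: locaddE. Qed.

Lemma zscale_regular (a : Z) (x : regmod) : a%:A *: x = a *: (x : H) :> H.
Proof. exact: mulr_algl. Qed.

Definition locring := locmod regmod.
HB.instance Definition _ := GRing.Zmodule.on locring.

Lemma locring_ind (P : locring -> Prop) :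
  (forall (h : H) a, P (locfrac (h : regmod) a)) -> forall x, P x.
Proof. by move=> PH; apply: locfrac_ind. Qed.

Lemma locringD (h h' : H) a b :
  (locfrac (h : regmod) a : locring) + locfrac (h' : regmod) b =
  locfrac (dv b *: h + dv a *: h' : regmod) (denomM a b).
Proof. by rewrite [LHS]locfracD !zscale_regular. Qed.

Section Action.
Variable M : lmodType H.

Definition locscale (x : locring) (y : locmod M) : locmod M :=
  locfrac (((repr x).1 : H) *: (repr y).1) (denomM (repr x).2 (repr y).2).

Lemma locscaleE (h : H) (m : M) a b :
  locscale (locfrac (h : regmod) a) (locfrac m b) = locfrac (h *: m) (denomM a b).
Proof.
have [s e] := locfrac_repr (h : regmod) a; have [s' e'] := locfrac_repr m b.
apply/locfracP; exists (denomM s s'); move: e e' => /=.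
case: (repr _) => x c /=; case: (repr _) => y d /=; rewrite !zscaleA => e e'.
have {}e : (dv s * dv a)%:A * (x : H) = (dv s * dv c)%:A * (h : H) := e.
transitivity (((dv s * dv a)%:A * (x : H)) *: ((dv s' * dv b)%:A *: y)).
  by rewrite -[RHS]scalerA -(zscaleH _ x) !zscaleA; congr (_%:A *: _); ring.
by rewrite e e' -[LHS]scalerA -(zscaleH _ h) !zscaleA; congr (_%:A *: _); ring.
Qed.

End Action.

Definition locmul (x y : locring) : locring := locscale x (y : locmod regmod).

Lemma locmulE (h h' : H) a b :
  locmul (locfrac (h : regmod) a) (locfrac (h' : regmod) b) =
  locfrac (h * h' : regmod) (denomM a b).
Proof. exact: locscaleE. Qed.

Fact locscaleA (M : lmodType H) x y (z : locmod M) :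
  locscale x (locscale y z) = locscale (locmul x y) z.
Proof.
elim/locring_ind: x => x a; elim/locring_ind: y => y b.
elim/locfrac_ind: z => z c.
rewrite locmulE !locscaleE.
have -> : x *: (y *: z : M) = (x * y) *: z by rewrite scalerA.
apply: locfrac_eq => /=.
by congr (_%:A *: _); ring.
Qed.

Definition locone : locring := locfrac (1 : regmod) denom1.

Fact locscale1 (M : lmodType H) (z : locmod M) : locscale locone z = z.
Proof.
elim/locfrac_ind: z => z c; rewrite locscaleE scale1r; apply: locfrac_eq => /=.
by rewrite mul1r.
Qed.

Fact locscaleDr (M : lmodType H) (x : locring) (y z : locmod M) :
  locscale x (y + z) = locscale x y + locscale x z.
Proof.
elim/locring_ind: x => x a; elim/locfrac_ind: y => y b.
elim/locfrac_ind: z => z c; rewrite !(locfracD, locscaleE); apply: locfrac_eq => /=.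
rewrite !scalerDr -!(zscaleH _ x) !zscaleA.
by congr (_ + _); congr (_%:A *: _); ring.
Qed.

Fact locscaleDl (M : lmodType H) (z : locmod M) :
  {morph (fun x => locscale x z) : x y / x + y}.
Proof.
move=> x y; elim/locring_ind: x => x a; elim/locring_ind: y => y b.
elim/locfrac_ind: z => z c; rewrite locringD !locscaleE locfracD.
apply: locfrac_eq => /=; rewrite scalerDl !scalerDr -(mulr_algl _ x) -(mulr_algl _ y).
have -> : ((dv b)%:A * x) *: z = (dv b)%:A *: (x *: z) by rewrite scalerA.
have -> : ((dv a)%:A * y) *: z = (dv a)%:A *: (y *: z) by rewrite scalerA.
by rewrite !zscaleA; congr (_ + _); congr (_%:A *: _); ring.
Qed.

Fact locmulA : associative locmul.
Proof. by move=> x y z; apply: locscaleA. Qed.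
Fact locmul1 : left_id locone locmul.
Proof. by move=> x; apply: locscale1. Qed.
Fact locmulr1 : right_id locone locmul.
Proof.
move=> x; elim/locring_ind: x => x a; rewrite locmulE.
by apply: locfrac_eq => /=; rewrite !mulr1.
Qed.
Fact locmulDl : left_distributive locmul +%R.
Proof. by move=> x y z; apply: locscaleDl. Qed.
Fact locmulDr : right_distributive locmul +%R.
Proof. by move=> x y z; apply: locscaleDr. Qed.

HB.instance Definition _ := GRing.Zmodule_isPzRing.Build locring
  locmulA locmul1 locmulr1 locmulDl locmulDr.

HB.instance Definition _ (M : lmodType H) :=
  GRing.Zmodule_isLmodule.Build locring (locmod M) (@locscaleA M)
    (@locscale1 M) (@locscaleDr M) (@locscaleDl M).

Definition loc_map (M : lmodType H) (m : M) : locmod M := locfrac m denom1.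

Lemma loc_mapD (M : lmodType H) : {morph @loc_map M : x y / x + y}.
Proof.
move=> x y; rewrite /loc_map locfracD; apply: locfrac_eq => /=.
by rewrite mulr1 !scale1r.
Qed.

Lemma loc_mapZ (M : lmodType H) (h : H) (m : M) :
  loc_map (h *: m) = (loc_map (h : regmod) : locring) *: loc_map m.
Proof.
rewrite [RHS]locscaleE; apply: locfrac_eq => /=.
by rewrite mulr1.
Qed.

Lemma loc_map0 (M : lmodType H) : loc_map (0 : M) = 0.
Proof. by []. Qed.

Lemma contract_closed (M : lmodType H) (U : submod (locmod M)) :
  subsemimod_closed (fun m : M => loc_map m \in U).
Proof.
split=> [|a x]; first split=> [|x y].
- by change (loc_map (0 : M) \in U); rewrite loc_map0 rpred0.
- by change (loc_map x \in U -> loc_map y \in U -> loc_map (x + y) \in U);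
    rewrite loc_mapD; apply: rpredD.
- by change (loc_map x \in U -> loc_map (a *: x) \in U);
    rewrite loc_mapZ; apply: rpredZ.
Qed.

(** M \cap U, for U a submodule of K \otimes_Z M *)
Definition contract (M : lmodType H) (U : submod (locmod M)) : submod M :=
  Submod (contract_closed U).

End Localisation.

Section Coxeter.
Variables (W : finGroupType) (S : {set W}).

(** the least n such that w is a product of n elements of S (0 if there is
    none) *)
Definition word_length (w : W) : nat :=
  if pselect (exists n, w \in (S ^+ n)%g) is left e then ex_minn e else 0.

(** The presentation < S | (s s')^m(s,s') = 1 > is expressed by its universal
    property. *)
Definition coxeter_system : Prop :=
  [/\ <<S>>%g = [set: W],
      forall s, s \in S -> #[s]%g = 2
    & forall (G : groupType) (f : W -> G),
        (forall s s', s \in S -> s' \in S ->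
           ((f s * f s') ^+ #[s * s'] = 1)%g) ->
        exists g : W -> G,
          {morph g : x y / (x * y)%g} /\ {in S, g =1 f}].

Definition weight_function (L : W -> nat) : Prop :=
  forall x y, word_length (x * y)%g = (word_length x + word_length y)%N ->
    L (x * y)%g = (L x + L y)%N.

Definition bruhat_step : rel W := fun x y =>
  (word_length x < word_length y)%N &&
  [exists s in S, exists u, y == (x * s ^ u)%g].

Definition bruhat_le : rel W := connect bruhat_step.
Definition bruhat_lt : rel W := fun x y => bruhat_le x y && (x != y).

End Coxeter.

(** A linear algebraic group over k is a Zariski closed subgroup of GL_n(k),
    given as a set of n x n matrices. *)

Section AlgebraicGroups.
Variable k : closedFieldType.

Definition eval_mx n (P : mpoly.mpoly (n * n) k) (A : 'M[k]_n) : k :=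
  mpoly.meval (fun i => mxvec A ord0 i) P.

Definition zariski_closed n (X : 'M[k]_n -> Prop) : Prop :=
  exists I : mpoly.mpoly (n * n) k -> Prop,
    forall A, X A <-> A \in unitmx /\ forall P, I P -> eval_mx P A = 0.

Definition is_subgroup n (X : 'M[k]_n -> Prop) : Prop :=
  [/\ forall A, X A -> A \in unitmx,
      X 1%:M,
      forall A B, X A -> X B -> X (A *m B)
    & forall A, X A -> X (invmx A)].

Definition algebraic_group n (X : 'M[k]_n -> Prop) : Prop :=
  zariski_closed X /\ is_subgroup X.

Definition zariski_connected n (X : 'M[k]_n -> Prop) : Prop :=
  forall Y Z : 'M[k]_n -> Prop, zariski_closed Y -> zariski_closed Z ->
    (forall A, X A -> Y A \/ Z A) ->
    (exists2 A, X A & Y A) -> (exists2 A, X A & Z A) ->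
    exists2 A, X A & Y A /\ Z A.

Definition subset_mx n (X Y : 'M[k]_n -> Prop) : Prop := forall A, X A -> Y A.

Definition simple_algebraic_group n (G : 'M[k]_n -> Prop) : Prop :=
  [/\ algebraic_group G,
      zariski_connected G,
      exists A B, [/\ G A, G B & A *m B <> B *m A]
    & forall N : 'M[k]_n -> Prop,
        algebraic_group N -> zariski_connected N -> subset_mx N G ->
        (forall A B, G A -> N B -> N (A *m B *m invmx A)) ->
        (forall A, N A -> A = 1%:M) \/ subset_mx G N].

Definition derived_mx n (X : 'M[k]_n -> Prop) : 'M[k]_n -> Prop := fun C =>
  forall Y : 'M[k]_n -> Prop, is_subgroup Y ->
    (forall A B, X A -> X B -> Y (A *m B *m invmx A *m invmx B)) -> Y C.

Definition solvable_mx n (X : 'M[k]_n -> Prop) : Prop :=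
  exists m, forall A, iter m (@derived_mx n) X A -> A = 1%:M.

Definition maximal_subset n (P : ('M[k]_n -> Prop) -> Prop)
    (G X : 'M[k]_n -> Prop) : Prop :=
  [/\ subset_mx X G, P X
    & forall Y, subset_mx Y G -> P Y -> subset_mx X Y -> subset_mx Y X].

Definition borel_subgroup n : ('M[k]_n -> Prop) -> ('M[k]_n -> Prop) -> Prop :=
  maximal_subset
    (fun B => [/\ algebraic_group B, zariski_connected B & solvable_mx B]).

Definition diagonalizable_group n (X : 'M[k]_n -> Prop) : Prop :=
  exists2 P, P \in unitmx & forall A, X A -> is_diag_mx (P *m A *m invmx P).

(** Tori are taken to be the connected diagonalizable groups. *)
Definition maximal_torus n : ('M[k]_n -> Prop) -> ('M[k]_n -> Prop) -> Prop :=
  maximal_subset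
    (fun T => [/\ algebraic_group T, zariski_connected T
                & diagonalizable_group T]).

(** The coordinate ring of GL_n is k[x_ij][1/det]. *)
Definition regular_on n (X : 'M[k]_n -> Prop) (f : 'M[k]_n -> k) : Prop :=
  exists (P : mpoly.mpoly (n * n) k) (e : nat),
    forall A, X A -> f A = eval_mx P A / \det A ^+ e.

Definition algebraic_hom n m (G : 'M[k]_n -> Prop) (G' : 'M[k]_m -> Prop)
    (f : 'M[k]_n -> 'M[k]_m) : Prop :=
  [/\ forall i j, regular_on G (fun A => f A i j),
      forall A, G A -> G' (f A)
    & forall A B, G A -> G B -> f (A *m B) = f A *m f B].

Definition image_mx n m (f : 'M[k]_n -> 'M[k]_m) (X : 'M[k]_n -> Prop) :
  'M[k]_m -> Prop := fun B => exists2 A, X A & f A = B.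

(** F is the restriction to G of (x_ij) |-> (x_ij^q), with q a nontrivial power
    of p, for some closed embedding i of G in a general linear group. *)
Definition standard_frobenius (p n : nat) (G : 'M[k]_n -> Prop)
    (F : 'M[k]_n -> 'M[k]_n) : Prop :=
  exists (m e : nat) (i : 'M[k]_n -> 'M[k]_m) (j : 'M[k]_m -> 'M[k]_n),
    let G' := image_mx i G in
    [/\ (0 < e)%N,
        algebraic_group G',
        algebraic_hom G G' i,
        algebraic_hom G' G j /\ (forall A, G A -> j (i A) = A)
      & forall A, G A -> i (F A) = map_mx (fun x => x ^+ (p ^ e)) (i A)].

Definition frobenius_map (p n : nat) (G : 'M[k]_n -> Prop)
    (F : 'M[k]_n -> 'M[k]_n) : Prop :=
  algebraic_hom G G F /\
  exists2 d, (0 < d)%N & standard_frobenius p G (iter d F).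

Definition stable_mx n (F : 'M[k]_n -> 'M[k]_n) (X : 'M[k]_n -> Prop) : Prop :=
  forall A, X A <-> image_mx F X A.

Definition normalizer_mx n (G T : 'M[k]_n -> Prop) : 'M[k]_n -> Prop := fun A =>
  G A /\ forall B, T B <-> T (A *m B *m invmx A).

(** [pi] exhibits [bW] as the Weyl group N_G(T) / T. *)
Definition weyl_quotient n (G T : 'M[k]_n -> Prop) (bW : finGroupType)
    (pi : 'M[k]_n -> bW) : Prop :=
  [/\ forall A B, normalizer_mx G T A -> normalizer_mx G T B ->
        pi (A *m B) = (pi A * pi B)%g,
      forall w, exists2 A, normalizer_mx G T A & pi A = w
    & forall A, normalizer_mx G T A -> (pi A = 1%g <-> T A)].

(** The simple reflections determined by a Borel subgroup B containing T are the
    nontrivial w such that B \cup BwB is a subgroup of G. *)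
Definition simple_reflections n (G B T : 'M[k]_n -> Prop) (bW : finGroupType)
    (pi : 'M[k]_n -> bW) : {set bW} :=
  [set w | (w != 1%g) && `[< exists A, [/\ normalizer_mx G T A, pi A = w
    & is_subgroup (fun C => B C \/
        exists X Y, [/\ B X, B Y & C = X *m A *m Y])] >]].

End AlgebraicGroups.

(** [F] induces [sigma] on the Weyl group [bW] with simple reflections [bS], and
    [iota] identifies W with the subgroup of [sigma]-fixed points. The first two
    clauses are classical consequences of the last one. *)
Definition standard_coxeter_system (W : finGroupType) (S : {set W})
    (L : W -> nat) : Prop :=
  [/\ coxeter_system S, weight_function S L, (2 <= #|S|)%N
    & exists (k : closedFieldType) (p n : nat) (G B T : 'M[k]_n -> Prop)
        (F : 'M[k]_n -> 'M[k]_n) (bW : finGroupType) (pi : 'M[k]_n -> bW)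
        (sigma : bW -> bW) (iota : W -> bW),
      let bS := simple_reflections G B T pi in
      [/\ [/\ p \in [pchar k], simple_algebraic_group G & frobenius_map p G F],
          [/\ borel_subgroup G B, maximal_torus G T, subset_mx T B,
              stable_mx F B & stable_mx F T],
          weyl_quotient G T pi /\
          (forall A, normalizer_mx G T A -> sigma (pi A) = pi (F A)),
          [/\ injective iota, {morph iota : x y / (x * y)%g}
            & forall w, (exists x, iota x = w) <-> sigma w = w]
        & (forall s, s \in S <-> exists2 r, r \in bS &
             let P := <<[set x | fconnect sigma r x]>>%g in
             iota s \in P /\
             forall x, x \in P -> (word_length bS x <= word_length bS (iota s))%N)
          /\ (forall w, L w = word_length bS (iota w))]].

Lemma standard_generates (W : finGroupType) (S : {set W}) (L : W -> nat) :
  standard_coxeter_system S L -> <<S>>%g = [set: W].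
Proof. by case=> -[]. Qed.

Definition tpow (n : int) : laurent := laurentX ^ n.

(** The generic Hecke algebra together with its bar involution and its bases
    [T_] and [kl_] (the elements c_w); all of these are determined by (W, S, L)
    up to isomorphism. *)
Record hecke_datum (W : finGroupType) (S : {set W}) (L : W -> nat) := HeckeDatum {
  hecke_alg :> algType laurent;
  T_ : W -> hecke_alg;
  hecke_basis : forall h : hecke_alg,
    exists! a : {ffun W -> laurent}, h = \sum_w a w *: T_ w;
  hecke_T1 : T_ 1%g = 1;
  hecke_mul_up : forall s w, s \in S -> bruhat_lt S w (s * w)%g ->
    T_ s * T_ w = T_ (s * w)%g;
  hecke_mul_down : forall s w, s \in S -> bruhat_lt S (s * w)%g w ->
    T_ s * T_ w = tpow (2 * (L s)%:Z) *: T_ (s * w)%g + (tpow (2 * (L s)%:Z) - 1) *: T_ w;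
  hecke_bar : {rmorphism hecke_alg -> hecke_alg};
  hecke_bar_invol : involutive hecke_bar;
  hecke_bar_t : hecke_bar laurentX%:A = laurentX^-1%:A;
  hecke_bar_T : forall w,
    hecke_bar (T_ w) * T_ (w^-1)%g = 1 /\ T_ (w^-1)%g * hecke_bar (T_ w) = 1;
  kl_ : W -> hecke_alg;
  kl_bar : forall w, hecke_bar (kl_ w) = kl_ w;
  kl_expand : forall w, exists p : W -> laurent,
    [/\ p w = 1,
        forall y, bruhat_lt S y w -> negative_laurent (p y)
      & kl_ w = \sum_(y | bruhat_le S y w) p y *: (tpow (- (L y)%:Z) *: T_ y)] }.

Section Cells.
Variables (W : finGroupType) (S : {set W}) (L : W -> nat).
Variable H : hecke_datum S L.
Local Notation T := (T_ H).
Local Notation c := (kl_ H).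

Definition leL_step : rel W := fun y w =>
  `[< exists2 s, s \in S & exists2 a : W -> laurent,
        c s * c w = \sum_x a x *: c x & a y != 0 >].

Definition leL : rel W := connect leL_step.
Definition leR : rel W := fun x y => leL (x^-1)%g (y^-1)%g.
Definition leLR : rel W := connect (fun x y => leL x y || leR x y).
Definition ltL : rel W := fun y w => leL y w && ~~ leL w y.
Definition simL : rel W := fun y w => leL y w && leL w y.

Definition left_cells : {set {set W}} := equivalence_partition simL [set: W].

Definition left_cell := {omega : {set W} | omega \in left_cells}.

Definition cell_leLR (omega omega' : left_cell) : Prop :=
  exists w w', [/\ w \in val omega, w' \in val omega' & leLR w w'].

Definition height_function (ht : left_cell -> int) : Prop :=
  [/\ forall omega, (ht omega < 0)%R,
      forall omega omega', cell_leLR omega omega' -> ~ cell_leLR omega' omega ->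
        (ht omega < ht omega')%R
    & forall omega omega', cell_leLR omega omega' -> cell_leLR omega' omega ->
        ht omega = ht omega'].

Definition cell_le (omega : left_cell) : {set W} :=
  [set y | [exists w in val omega, leL y w]].
Definition cell_lt (omega : left_cell) : {set W} :=
  [set y | [exists w in val omega, ltL y w]].

Definition kl_span (A : {set W}) : {pred regmod H} := fun h =>
  `[< exists a : W -> laurent, h = \sum_(y in A) a y *: c y :> H >].

Definition leL_closed (A : {set W}) : Prop :=
  forall y w, leL y w -> w \in A -> y \in A.

Lemma cell_le_closed omega : leL_closed (cell_le omega).
Proof.
move=> y w yw; rewrite !inE => /existsP [x /andP [xo wx]].
by apply/existsP; exists x; rewrite xo; exact: connect_trans yw wx.
Qed.

Lemma cell_lt_closed omega : leL_closed (cell_lt omega).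
Proof.
move=> y w yw; rewrite !inE => /existsP [x /and3P [xo wx xw]].
apply/existsP; exists x; apply/and3P; split=> //; first exact: connect_trans yw wx.
by apply: contra xw => xy; exact: connect_trans xy yw.
Qed.

Lemma word_lengthP (w : W) : <<S>>%g = [set: W] ->
  w \in (S ^+ word_length S w)%g /\
  forall n, w \in (S ^+ n)%g -> (word_length S w <= n)%N.
Proof.
move=> genS; rewrite /word_length; case: pselect => [e|]; first by case: ex_minnP.
case; have /gen_prodgP [n [u uS ->]] : w \in <<S>>%g by rewrite genS inE.
exists n; elim: n u uS => [|n IHn] u uS; first by rewrite big_ord0 expg0 inE.
by rewrite big_ord_recl expgS mem_mulg // IHn // => i; apply: uS.
Qed.

Lemma word_length1 : <<S>>%g = [set: W] -> word_length S 1%g = 0.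
Proof.
move=> /(word_lengthP 1%g) [_ min]; apply/eqP; rewrite -leqn0; apply: min.
by rewrite expg0 inE.
Qed.

Lemma word_split (w : W) : <<S>>%g = [set: W] -> w != 1%g ->
  exists s w', [/\ s \in S, w = (s * w')%g & bruhat_lt S w' w].
Proof.
move=> genS w1; have [wS _] := word_lengthP w genS.
case lw : (word_length S w) wS => [|n]; first by rewrite expg0 inE (negPf w1).
rewrite expgS => /mulsgP [s w' sS w'S dw]; exists s, w'.
have lw' : (word_length S w' < word_length S w)%N.
  by rewrite lw ltnS; apply: (word_lengthP w' genS).2.
split=> //; rewrite /bruhat_lt; apply/andP; split; last first.
  by apply: contraTneq lw' => ->; rewrite ltnn.
apply: connect1; rewrite /bruhat_step lw' /=.
apply/existsP; exists s; rewrite sS; apply/existsP; exists w'.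
by rewrite dw conjgE mulgA mulgV mul1g.
Qed.

Lemma bruhat_lt_length x y : bruhat_lt S x y ->
  (word_length S x < word_length S y)%N.
Proof.
rewrite /bruhat_lt => /andP [/connectP [p]].
elim: p x => [|z p IHp] x /=; first by move=> _ ->; rewrite eqxx.
move=> /andP [/andP [xz _] pz] dy _; apply: leq_trans xz _.
by have [-> //|zy] := eqVneq z y; apply: ltnW; apply: IHp.
Qed.

Lemma tpow_unit n : tpow n \is a GRing.unit.
Proof. by rewrite unitrXz // laurentX_unit. Qed.

Lemma kl_spanP (A : {set W}) (h : H) :
  reflect (exists a : W -> laurent, h = \sum_(y in A) a y *: c y)
          ((h : regmod H) \in kl_span A).
Proof. exact: asboolP. Qed.

Lemma kl_span0 (A : {set W}) : (0 : regmod H) \in kl_span A.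
Proof.
apply/(kl_spanP A 0); exists (fun=> 0).
by rewrite big1 // => y _; rewrite scale0r.
Qed.

Lemma kl_spanD (A : {set W}) (u v : H) :
  (u : regmod H) \in kl_span A -> (v : regmod H) \in kl_span A ->
  (u + v : regmod H) \in kl_span A.
Proof.
move=> /kl_spanP [a ->] /kl_spanP [b ->]; apply/kl_spanP.
exists (fun y => a y + b y); rewrite -big_split.
by apply: eq_bigr => y _; rewrite scalerDl.
Qed.

Lemma kl_spanZ (A : {set W}) z (u : H) :
  (u : regmod H) \in kl_span A -> (z *: u : regmod H) \in kl_span A.
Proof.
move=> /kl_spanP [a ->]; apply/kl_spanP; exists (fun y => z * a y).
by rewrite scaler_sumr; apply: eq_bigr => y _; rewrite scalerA.
Qed.

Lemma kl_spanB (A : {set W}) (u v : H) :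
  (u : regmod H) \in kl_span A -> (v : regmod H) \in kl_span A ->
  (u - v : regmod H) \in kl_span A.
Proof.
by move=> uA vA; rewrite -[v]scale1r -scaleNr; apply: kl_spanD => //; apply: kl_spanZ.
Qed.

Lemma kl_span_sum (A : {set W}) I (r : seq I) (P : pred I) (F : I -> H) :
  (forall i, P i -> (F i : regmod H) \in kl_span A) ->
  (\sum_(i <- r | P i) F i : regmod H) \in kl_span A.
Proof.
move=> FA; elim/big_rec: _ => [|i u Pi uA]; first exact: kl_span0.
by apply: kl_spanD uA; apply: FA.
Qed.

Lemma kl_span_gen (A : {set W}) y : y \in A -> (c y : regmod H) \in kl_span A.
Proof.
move=> yA; apply/kl_spanP; exists (fun x => (x == y)%:R).
rewrite (bigD1 y) //= eqxx scale1r big1 ?addr0 // => x /andP [_ /negPf ->].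
by rewrite scale0r.
Qed.

Lemma kl_expand_lead w : exists p : W -> laurent,
  c w = tpow (- (L w)%:Z) *: T w + \sum_(y | bruhat_lt S y w) p y *: T y.
Proof.
have [p [pw _ ->]] := kl_expand H w.
exists (fun y => p y * tpow (- (L y)%:Z)).
rewrite (bigD1 w) /=; last exact: connect0.
by rewrite pw scale1r; congr (_ + _); apply: eq_bigr => y _; rewrite scalerA.
Qed.

Lemma kl_T w : exists p : W -> laurent,
  T w = tpow (L w) *: (c w - \sum_(y | bruhat_lt S y w) p y *: T y).
Proof.
have [p ->] := kl_expand_lead w; exists p; rewrite addrK scalerA /tpow.
by rewrite -invr_expz mulrV ?scale1r //; exact: (tpow_unit (L w)).

Qed.

Lemma kl_span_T w : (T w : regmod H) \in kl_span setT.
Proof.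
have [n] := ubnP (word_length S w); elim: n w => // n IHn w; rewrite ltnS => wn.
have [p ->] := kl_T w; apply/kl_spanZ/kl_spanB; first exact: kl_span_gen.
apply: kl_span_sum => y yw; apply/kl_spanZ/IHn.
exact: leq_trans (bruhat_lt_length yw) wn.
Qed.

Lemma kl_span_all (h : H) : (h : regmod H) \in kl_span setT.
Proof.
have [a [-> _]] := hecke_basis h.
by apply: kl_span_sum => w _; apply/kl_spanZ/kl_span_T.
Qed.

Lemma kl_span_mul (A : {set W}) : <<S>>%g = [set: W] -> leL_closed A ->
  forall h u : H, (u : regmod H) \in kl_span A -> (h * u : regmod H) \in kl_span A.
Proof.
move=> genS clA.
have mulc s y : s \in S -> y \in A -> (c s * c y : regmod H) \in kl_span A.
  move=> sS yA; have /kl_spanP [a e] := kl_span_all (c s * c y).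
  rewrite e; apply: kl_span_sum => x _.
  have [->|ax] := eqVneq (a x) 0; first by rewrite scale0r kl_span0.
  apply/kl_spanZ/kl_span_gen/(clA x y) => //; apply: connect1; apply/asboolP.
  by exists s => //; exists a => //; rewrite e; apply: eq_bigl => z; rewrite inE.
have mulT s u : s \in S -> (u : regmod H) \in kl_span A ->
    (T s * u : regmod H) \in kl_span A.
  move=> sS uA; have [p ->] := kl_T s; rewrite -scalerAl; apply: kl_spanZ.
  rewrite mulrBl; apply: kl_spanB.
    move/kl_spanP: uA => [a ->]; rewrite mulr_sumr; apply: kl_span_sum => y yA.
    by rewrite -scalerAr; apply/kl_spanZ/mulc.
  rewrite mulr_suml; apply: kl_span_sum => y /bruhat_lt_length ys.
  suff -> : y = 1%g by rewrite hecke_T1 -scalerAl mul1r; apply: kl_spanZ.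
  have ls : (word_length S s <= 1)%N by apply: (word_lengthP s genS).2; rewrite expg1.
  have [yS _] := word_lengthP y genS.
  have y0 : word_length S y = 0 by apply/eqP; rewrite -leqn0 -ltnS (leq_trans ys).
  by move: yS; rewrite y0 expg0 inE => /eqP.
have mulTw w u : (u : regmod H) \in kl_span A -> (T w * u : regmod H) \in kl_span A.
  have [n] := ubnP (word_length S w); elim: n w u => // n IHn w u; rewrite ltnS => wn uA.
  have [->|w1] := eqVneq w 1%g; first by rewrite hecke_T1 mul1r.
  have [s [w' [sS dw ww']]] := word_split genS w1.
  rewrite dw -(hecke_mul_up H sS) -?dw // -mulrA; apply/mulT/IHn => //.
  exact: leq_trans (bruhat_lt_length ww') wn.
move=> h u uA; have [a [-> _]] := hecke_basis h.
rewrite mulr_suml; apply: kl_span_sum => w _.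
by rewrite -scalerAl; apply/kl_spanZ/mulTw.
Qed.

Lemma kl_span_closed (A : {set W}) : <<S>>%g = [set: W] -> leL_closed A ->
  subsemimod_closed (kl_span A).
Proof.
move=> genS clA; split=> [|h u]; first split=> [|u v].
- exact: kl_span0.
- exact: kl_spanD.
- exact: kl_span_mul.
Qed.

Variable std : standard_coxeter_system S L.

Definition cell_le_submod omega : submod (regmod H) :=
  Submod (kl_span_closed (standard_generates std) (cell_le_closed (omega := omega))).
Definition cell_lt_submod omega : submod (regmod H) :=
  Submod (kl_span_closed (standard_generates std) (cell_lt_closed (omega := omega))).

(** The span of the c_y with y <=_L w modulo the span of those with y <_L w, for
    any w in omega. *)
Definition cell_module (omega : left_cell) : lmodType H :=
  subquot (cell_le_submod omega) (cell_lt_submod omega).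

Definition x_ (J : {set W}) : H := \sum_(w in <<J>>%g) T w.

Lemma ideal_closed (x : regmod H) :
  subsemimod_closed (fun h : regmod H => `[< exists a : H, h = a *: x >]).
Proof.
split=> [|a u]; first split=> [|u v].
- by apply/asboolP; exists 0; rewrite scale0r.
- by move=> /asboolP [a ->] /asboolP [b ->]; apply/asboolP; exists (a + b);
    rewrite scalerDl.
- by move=> /asboolP [b ->]; apply/asboolP; exists (a * b); rewrite scalerA.
Qed.

Definition Hx (J : {set W}) : lmodType H :=
  submodType (Submod (ideal_closed (x_ J))).

End Cells.

Section Exact.
Variables (W : finGroupType) (S : {set W}) (L : W -> nat).
Variables (H : hecke_datum S L) (std : standard_coxeter_system S L).
Variable ht : left_cell H -> int.

Local Notation cellmod := (cell_module std).

Definition has_height (E : lmodType (locring H)) (h : int) : Prop :=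
  exists2 omega : left_cell H, ht omega = h & occurs_in E (locmod (cellmod omega)).

(** M_h: every finite torsion-free M embeds in [locmod M], and M_h is decreasing
    in h. *)
Definition filt (M : lmodType H) (h : int) : submod M :=
  contract (submod_sum (fun U : submod (locmod M) =>
    irreducible (submodType U) /\
    exists2 h', has_height (submodType U) h' & (h' < - h)%R)).

Definition gr (M : lmodType H) (h : int) : lmodType H :=
  subquot (filt M (h - 1)) (filt M h).

Definition torsion_free (M : lmodType H) : Prop :=
  forall (a : laurent) (m : M), (a%:A : H) *: m = 0 -> a = 0 \/ m = 0.

Definition in_A (M : lmodType H) : Prop :=
  [/\ finitely_generated M, torsion_free M
    & forall h : int, exists (n : nat) (omega : 'I_n -> left_cell H),
        (forall i, ht (omega i) = - h) /\
        is_direct_sum (gr M h) (fun i => cellmod (omega i))].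

(** [phi] is the map M_{h-1} / M_h -> N_{h-1} / N_h induced by [f]. *)
Definition induced (M N : lmodType H) (f : {linear M -> N}) (h : int)
    (phi : {linear gr M h -> gr N h}) : Prop :=
  forall m : submodType (filt M (h - 1)),
    exists2 n : submodType (filt N (h - 1)), val n = f (val m) &
      phi (subquot_proj _ m) = subquot_proj _ n.

Definition in_E (M N P : lmodType H) (f : {linear M -> N}) (g : {linear N -> P}) :
    Prop :=
  [/\ [/\ in_A M, in_A N & in_A P], short_exact f g
    & forall h : int,
        exists (phi : {linear gr M h -> gr N h}) (psi : {linear gr N h -> gr P h}),
          [/\ induced f phi, induced g psi & split_exact phi psi]].

Definition invariants (I : {set W}) (M : lmodType H) (V : submod M) : M -> Prop :=
  fun v => v \in V /\
    forall s, s \in I -> T_ H s *: v = ((tpow (2 * (L s)%:Z))%:A : H) *: v.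

Definition in_Eflat (M N P : lmodType H) (f : {linear M -> N})
    (g : {linear N -> P}) : Prop :=
  in_E f g /\
  forall (h : int) (I : {set W}), I \subset S ->
    exact_on 0 f g (invariants I (filt M h)) (invariants I (filt N h))
      (invariants I (filt P h)).

(** Extensions of Y by Z; their equivalence classes are represented as subsets of
    [extension]. *)
Section Ext.
Variables Y Z : lmodType H.

Record extension := Extension {
  ext_mod : lmodType H;
  ext_inj : {linear Z -> ext_mod};
  ext_proj : {linear ext_mod -> Y} }.

Definition ext_equiv (xi xi' : extension) : Prop :=
  exists phi : {linear ext_mod xi -> ext_mod xi'},
    [/\ bijective phi,
        forall z, phi (ext_inj xi z) = ext_inj xi' z
      & forall e, ext_proj xi' (phi e) = ext_proj xi e].

Definition ext_class (xi : extension) : extension -> Prop := fun xi' =>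
  in_Eflat (ext_inj xi') (ext_proj xi') /\ ext_equiv xi xi'.

Definition Ext1 : (extension -> Prop) -> Prop := fun C =>
  exists2 xi, in_Eflat (ext_inj xi) (ext_proj xi) & C = ext_class xi.

Definition split_inj (z : Z) : (Z * Y)%type := (z, 0).
Definition split_proj (e : (Z * Y)%type) : Y := e.2.

Lemma split_inj_linear : linear split_inj.
Proof. by move=> a x y; congr pair; rewrite /= scaler0 addr0. Qed.
Lemma split_proj_linear : linear split_proj.
Proof. by []. Qed.
HB.instance Definition _ := GRing.isLinear.Build H Z (Z * Y)%type _ split_inj
  split_inj_linear.
HB.instance Definition _ := GRing.isLinear.Build H (Z * Y)%type Y _ split_proj
  split_proj_linear.

(** The zero of the Baer group is the class of 0 -> Z -> Z \oplus Y -> Y -> 0. *)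
Definition Ext1_zero : extension -> Prop :=
  ext_class (Extension split_inj split_proj).

End Ext.
End Exact.

Arguments Ext1 {W S L H} std ht Y Z _.
Arguments Ext1_zero {W S L H} std ht Y Z _.

(* Main.v *)
From HB Require Import structures.
Require Import Defs.
From mathcomp Require Import all_boot all_order all_fingroup all_algebra.
From mathcomp Require Import generic_quotient boolp ring zify.

Set Implicit Arguments.
Unset Strict Implicit.
Unset Printing Implicit Defensive.

Import GRing.Theory Num.Theory.

Local Open Scope ring_scope.
Local Open Scope quotient_scope.

(** Let 0 -> S(omega) -> E -> H x_J -> 0 belong to E^flat. If x_J lies in the term
    of the height filtration of H x_J of index 0, exactness on J-invariants lifts
    x_J to some v in E with T_s v = t^(2 L(s)) v for s in J, and then
    h x_J |-> h v is a section: it is well defined because x_J v = P v with P the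
    Poincare polynomial of <J>, and E is torsion free.

    Since heights are negative, x_J lies in that term as soon as every left
    ideal of H_K is a sum of irreducible ones, each occurring in some S(omega)_K.
    The form with orthogonal basis (T_w), <T_w, T_w> = t^(2 L(w)), makes every T_s
    self-adjoint and is anisotropic because 0 is not a sum of nonzero
    squares in Q(t); orthogonal complements then give semisimplicity. An
    irreducible left ideal maps nontrivially to a left cell module by filtering H
    by the spans of the leL-closed subsets of (c_w). *)

(** * Sums of squares in Q(t) *)

Lemma laurent_poly_subproof (P : {poly int}) : tofrac P \in laurent_pred.
Proof. by apply/laurent_predP; exists P, 0; rewrite expr0 mulr1. Qed.

Definition laurent_poly (P : {poly int}) : laurent :=
  Laurent (laurent_poly_subproof P).

(** The product of the denominators of chosen representatives clears all the [x i] at once. *)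
Lemma frac_common_denom (I : finType) (x : I -> ratfun) :
  exists2 d : {poly int}, d != 0 &
    exists p : I -> {poly int}, forall i, tofrac d * x i = tofrac (p i).
Proof.
have /choice [q hq] : forall i, exists q : {poly int} * {poly int},
    q.2 != 0 /\ tofrac q.2 * x i = tofrac q.1.
  move=> i; exists (frac (repr (x i))); case: (repr (x i)) (reprK (x i)) => -[n d] /= d0 <-.
  split=> //; unlock tofrac; rewrite -[LHS]FracField.pi_mul; apply/eqmodP.
  rewrite /= FracField.equivfE /FracField.mulf /=.
  by rewrite !numden_Ratio ?mulf_neq0 ?oner_neq0 //= mul1r mulr1 mulrC.
exists (\prod_i (q i).2); first by apply/prodf_neq0 => i _; have [] := hq i.
exists (fun i => (q i).1 * \prod_(j | j != i) (q j).2) => i.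
have [_ e] := hq i.
by rewrite (bigD1 i) //= !tofracM -e; ring.
Qed.

(** At every integer the values form a vanishing sum of integer squares, so each [p i] has
    infinitely many roots. *)
Lemma poly_int_sqr_sum (I : finType) (p : I -> {poly int}) :
  \sum_i p i ^+ 2 = 0 -> forall i, p i = 0.
Proof.
move=> e i.
have z (n : int) : (p i).[n] = 0.
  have /eqP := congr1 (horner^~ n) e; rewrite horner_sum horner0.
  rewrite psumr_eq0 => [/allP /(_ i (mem_index_enum i))|j _]; rewrite horner_exp.
    by rewrite sqrf_eq0 => /eqP.
  exact: sqr_ge0.
apply/eqP/negP => /negP p0.
(* The integers below [size (p i)] are already one root too many for a nonzero polynomial. *)
have := max_poly_roots p0 (rs := [seq n%:Z | n <- iota 0 (size (p i))]).
rewrite size_map size_iota ltnn => h; apply/notF/h.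
  by apply/allP => _ /mapP [n _ ->]; rewrite rootE z.
by rewrite map_inj_uniq ?iota_uniq // => m n [].
Qed.

Lemma ratfun_sqr_sum (I : finType) (x : I -> ratfun) :
  \sum_i x i ^+ 2 = 0 -> forall i, x i = 0.
Proof.
move=> e i; have [d d0 [p hp]] := frac_common_denom x.
have pz : p i = 0.
  apply: poly_int_sqr_sum; apply/eqP; rewrite -(tofrac_eq0 (\sum_i _)).
  rewrite rmorph_sum /= (eq_bigr (fun i => tofrac d ^+ 2 * x i ^+ 2)).
    by rewrite -mulr_sumr e mulr0.
  by move=> j _; rewrite -exprMn hp tofracXn.
by have /eqP := hp i; rewrite pz tofrac0 mulf_eq0 tofrac_eq0 (negPf d0) => /eqP.
Qed.

(** At t = 1 every term becomes 1. This will apply to the Poincare polynomial of [<<J>>]. *)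
Lemma tpow_sum_neq0 (I : finType) (P : pred I) (e : I -> nat) (i : I) :
  P i -> \sum_(i | P i) tpow (e i)%:Z != 0.
Proof.
move=> Pi; apply/eqP => /(congr1 val).
rewrite rmorph_sum rmorph0 => /eqP.
rewrite (eq_bigr (fun i => tofrac ('X^(e i) : {poly int}))); last first.
  by move=> j _; rewrite tofracXn; exact: (rmorphXn (val : laurent -> ratfun)).
rewrite -rmorph_sum tofrac_eq0 => /eqP /(congr1 (horner^~ 1)) /eqP.
rewrite horner_sum horner0 psumr_eq0 => [/allP /(_ i (mem_index_enum i))|j _].
  by rewrite Pi hornerXn expr1n.
by rewrite hornerXn expr1n.
Qed.

(** * The symmetric form on the Hecke algebra *)

Section Coxeter.
Variables (W : finGroupType) (S : {set W}).
Hypothesis coxS : coxeter_system S.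

Lemma coxeter_mulKg s w : s \in S -> (s * (s * w) = w)%g.
Proof.
case: coxS => _ ord2 _ sS; rewrite mulgA.
by have := expg_order s; rewrite ord2 // expgS expg1 => ->; rewrite mul1g.
Qed.

(* The sign character, obtained from the universal property, separates the
   parities. *)
Lemma word_length_mul_neq s w : s \in S ->
  word_length S (s * w)%g <> word_length S w.
Proof.
case: coxS => genS ord2 univ sS eqL.
pose f (w : W) : {perm bool} := tperm true false.
have f2 x y : (f x * f y = 1)%g by exact: tperm2.
have [|g [gM gS]] := univ {perm bool} f; first by move=> x y _ _; rewrite f2 expg1n.
have gL n x : x \in (S ^+ n)%g -> g x = (tperm true false ^+ n)%g.
  elim: n x => [|n IHn] x.
    by rewrite expg0 inE => /eqP ->; apply: (mulgI (g 1%g)); rewrite -gM !mulg1.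
  by rewrite expgS => /mulsgP [a b aS bS ->]; rewrite gM gS // (IHn b) // expgS.
have [sw _] := word_lengthP (s * w)%g genS.
have [w' _] := word_lengthP w genS.
have := gL _ _ sw; rewrite eqL -(gL _ _ w') gM gS // => /(canRL (mulgK _)).
rewrite mulgV => /permP /(_ true); by rewrite tpermL perm1.
Qed.

Lemma word_length_mul_le s w : s \in S ->
  (word_length S (s * w)%g <= (word_length S w).+1)%N.
Proof.
move=> sS; have [genS _ _] := coxS.
apply: (word_lengthP (s * w)%g genS).2; rewrite expgS mem_mulg //.
exact: (word_lengthP w genS).1.
Qed.

(** Since [s * w = w * s ^ w], the two elements differ by a reflection, and an increase of length is
    already a Bruhat step. *)
Lemma bruhat_lt_mulE s w : s \in S ->
  bruhat_lt S w (s * w)%g = (word_length S w < word_length S (s * w)%g)%N.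
Proof.
move=> sS; apply/idP/idP; first exact: bruhat_lt_length.
move=> lt; apply/andP; split; last by apply: contraTneq lt => <-; rewrite ltnn.
apply: connect1; rewrite /bruhat_step lt /=; apply/existsP; exists s; rewrite sS /=.
by apply/existsP; exists w; rewrite conjgE mulgA mulgV mul1g.
Qed.

(** Lengths of [w] and [s * w] never agree, so exactly one of the two multiplication rules of the
    Hecke algebra applies. *)
Lemma bruhat_lt_mulN s w : s \in S ->
  bruhat_lt S (s * w)%g w = ~~ bruhat_lt S w (s * w)%g.
Proof.
move=> sS; rewrite -{2}(coxeter_mulKg w sS) !bruhat_lt_mulE // coxeter_mulKg //.
by have := @word_length_mul_neq s w sS; lia.
Qed.

Lemma word_length_gen s : s \in S -> word_length S s = 1%N.
Proof.
move=> sS; have [genS _ _] := coxS.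
have := word_length_mul_le 1 sS; have := @word_length_mul_neq s 1%g sS.
by rewrite mulg1 word_length1 //; case: (word_length S s) => [|[]].
Qed.

Lemma weight_mul_up (L : W -> nat) s w : weight_function S L -> s \in S ->
  bruhat_lt S w (s * w)%g -> L (s * w)%g = (L s + L w)%N.
Proof.
move=> wL sS; rewrite bruhat_lt_mulE // => lt; apply: wL.
by apply/eqP; rewrite (word_length_gen sS) eqn_leq word_length_mul_le // add1n.
Qed.

End Coxeter.

(** * Coordinates in the basis [T_] and the form *)

Section Coordinates.
Variables (W : finGroupType) (S : {set W}) (L : W -> nat) (H : hecke_datum S L).
Local Notation T := (T_ H).

Definition hcoef (h : H) : {ffun W -> laurent} := sval (cid (hecke_basis h)).

Lemma hcoefE (h : H) : h = \sum_w hcoef h w *: T w.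
Proof. by rewrite /hcoef; case: cid => a []. Qed.

Lemma hcoefP (h : H) (a : W -> laurent) : h = \sum_w a w *: T w -> hcoef h =1 a.
Proof.
move=> e w; rewrite /hcoef; case: cid => b [_ /= uniq].
by rewrite (uniq [ffun w => a w]) ?ffunE // e; apply: eq_bigr => x _; rewrite ffunE.
Qed.

Lemma hcoef0 w : hcoef 0 w = 0.
Proof. by apply: hcoefP; rewrite big1 // => x _; rewrite scale0r. Qed.

Lemma hcoefD (h k : H) w : hcoef (h + k) w = hcoef h w + hcoef k w.
Proof.
apply: (hcoefP (a := fun w => hcoef h w + hcoef k w)).
rewrite {1}(hcoefE h) {1}(hcoefE k) -big_split.
by apply: eq_bigr => x _; rewrite scalerDl.
Qed.

Lemma hcoefZ z (h : H) w : hcoef (z *: h) w = z * hcoef h w.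
Proof.
apply: (hcoefP (a := fun w => z * hcoef h w)).
by rewrite {1}(hcoefE h) scaler_sumr; apply: eq_bigr => x _; rewrite scalerA.
Qed.

Lemma hcoef_sum (I : Type) (r : seq I) (P : pred I) (F : I -> H) w :
  hcoef (\sum_(i <- r | P i) F i) w = \sum_(i <- r | P i) hcoef (F i) w.
Proof.
elim: r => [|i r IHr]; first by rewrite !big_nil hcoef0.
by rewrite !big_cons; case: ifP => // _; rewrite hcoefD IHr.
Qed.

Lemma hcoef_inj (h k : H) : hcoef h =1 hcoef k -> h = k.
Proof. by move=> e; rewrite (hcoefE h) (hcoefE k); apply: eq_bigr => w _; rewrite e. Qed.

Lemma hcoefT x w : hcoef (T x) w = (w == x)%:R.
Proof.
apply: (hcoefP (a := fun w => (w == x)%:R)); rewrite (bigD1 x) //= eqxx scale1r.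
by rewrite big1 ?addr0 // => y /negPf ->; rewrite scale0r.
Qed.

Lemma hecke_eq0 z (h : H) : z *: h = 0 -> z = 0 \/ h = 0.
Proof.
move=> e; have [->|z0] := eqVneq z 0; [by left | right].
apply: hcoef_inj => w; rewrite hcoef0; apply: (mulfI z0).
by rewrite -hcoefZ e hcoef0 mulr0.
Qed.

Hypothesis std : standard_coxeter_system S L.

Let coxS : coxeter_system S. Proof. by case: std. Qed.
Let weightL : weight_function S L. Proof. by case: std. Qed.

(** Splitting generators off [w] one at a time, with the length going down, builds every [T w] from
    1. Stability under H can thus be tested on the [T s]. *)
Lemma hecke_ind (P : H -> Prop) :
  (forall h k, P h -> P k -> P (h + k)) -> (forall z h, P h -> P (z *: h)) ->
  P 1 -> (forall s h, s \in S -> P h -> P (T s * h)) -> forall h, P h.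
Proof.
have [genS _ _] := coxS.
move=> PD PZ P1 PT h; rewrite (hcoefE h); apply: (big_ind P) => //.
  by rewrite -(scale0r 1); apply: PZ.
move=> w _; apply: PZ.
have [n] := ubnP (word_length S w); elim: n w => // n IHn w; rewrite ltnS => wn.
have [->|w1] := eqVneq w 1%g; first by rewrite hecke_T1.
have [s [w' [sS dw ww']]] := word_split genS w1.
rewrite dw -(hecke_mul_up H sS) -?dw //; apply/PT/IHn => //.
exact: leq_trans (bruhat_lt_length ww') wn.
Qed.

Local Notation q s := (tpow (2 * (L s)%:Z)).

Lemma hcoef_mulT s (h : H) w : s \in S ->
  hcoef (T s * h) w = if bruhat_lt S w (s * w)%g then q s * hcoef h (s * w)%g
                     else hcoef h (s * w)%g + (q s - 1) * hcoef h w.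
Proof.
move=> sS; rewrite {1}(hcoefE h) mulr_sumr hcoef_sum.
have reidx (F : W -> laurent) : \sum_x F x *+ (w == s * x)%g = F (s * w)%g.
  rewrite (bigD1 (s * w)%g) //= (coxeter_mulKg coxS) // eqxx big1 ?addr0 // => x.
  by case: (w =P (s * x)%g) => // ->; rewrite (coxeter_mulKg coxS) // eqxx.
have delta (F : W -> laurent) : \sum_x F x *+ (w == x) = F w.
  rewrite (bigD1 w) //= eqxx big1 ?addr0 // => x.
  by rewrite eq_sym => /negPf ->.
(* The product [T s * T x] only involves [T (s * x)] and, on a descent, [T x]; the terms are sorted
   by which of the two equals [T w]. *)
transitivity (\sum_x ((if bruhat_lt S x (s * x)%g then hcoef h x else q s * hcoef h x)
     *+ (w == s * x)%g + (if bruhat_lt S x (s * x)%g then 0 else hcoef h x * (q s - 1))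
     *+ (w == x))).
  apply: eq_bigr => x _; rewrite -scalerAr hcoefZ.
  case: ifP => [up|/negbT]; first by rewrite hecke_mul_up // hcoefT mul0rn addr0 mulr_natr.
  rewrite -(bruhat_lt_mulN coxS) // => dn; rewrite hecke_mul_down // hcoefD !hcoefZ !hcoefT.
  by rewrite mulrDr !mulrA !mulr_natr [hcoef h x * q s]mulrC.
rewrite big_split reidx delta (coxeter_mulKg coxS) // (bruhat_lt_mulN coxS) //.
by case: bruhat_lt => /=; rewrite ?addr0 // [hcoef h w * _]mulrC.
Qed.

(* tau(h k'), for the trace tau with tau(T_w) = [w = 1] and k |-> k' the
   anti-involution T_w |-> T_(w^-1) *)
Definition hform (h k : H) : laurent :=
  \sum_w tpow (2 * (L w)%:Z) * (hcoef h w * hcoef k w).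

Lemma hformC h k : hform h k = hform k h.
Proof. by apply: eq_bigr => w _; rewrite [hcoef h w * _]mulrC. Qed.

Lemma hformDl h h' k : hform (h + h') k = hform h k + hform h' k.
Proof. by rewrite -big_split; apply: eq_bigr => w _ /=; rewrite hcoefD; ring. Qed.

Lemma hformZl z h k : hform (z *: h) k = z * hform h k.
Proof. by rewrite mulr_sumr; apply: eq_bigr => w _; rewrite hcoefZ; ring. Qed.

Lemma hform0l k : hform 0 k = 0.
Proof. by rewrite -(scale0r 0) hformZl mul0r. Qed.

Lemma tpowD m n : tpow (m + n) = tpow m * tpow n.
Proof. by rewrite /tpow exprzDr // laurentX_unit. Qed.

(** Pairing [w] with [s * w] rewrites the left side as [F h k + F k h + G h k] with [G] symmetric,
    an expression symmetric in [h] and [k]. *)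
Lemma hform_mulT s h k : s \in S -> hform (T s * h) k = hform h (T s * k).
Proof.
move=> sS.
pose F h k := \sum_(w | bruhat_lt S w (s * w)%g)
  tpow (2 * (L (s * w)%g)%:Z) * (hcoef h (s * w)%g * hcoef k w).
pose G h k := \sum_(w | ~~ bruhat_lt S w (s * w)%g)
  tpow (2 * (L w)%:Z) * ((q s - 1) * (hcoef h w * hcoef k w)).
have FG h' k' : hform (T s * h') k' = F h' k' + F k' h' + G h' k'.
  rewrite /hform (bigID (fun w => bruhat_lt S w (s * w)%g)) /= -addrA; congr (_ + _).
    apply: eq_bigr => w up; rewrite hcoef_mulT // up (weight_mul_up coxS) //.
    by rewrite PoszD mulrDr tpowD; ring.
  (* Left multiplication by [s] exchanges ascents and descents. *)
  have -> : F k' h' = \sum_(w | ~~ bruhat_lt S w (s * w)%g)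
      tpow (2 * (L w)%:Z) * (hcoef k' w * hcoef h' (s * w)%g).
    rewrite /F (reindex_inj (mulgI s)) /=.
    rewrite (eq_bigl (fun w => ~~ bruhat_lt S w (s * w)%g)) => [|w]; last first.
      by rewrite (coxeter_mulKg coxS) // (bruhat_lt_mulN coxS).
    by apply: eq_bigr => w _; rewrite (coxeter_mulKg coxS).
  rewrite -big_split /=; apply: eq_bigr => w /negbTE dn.
  by rewrite hcoef_mulT // dn; ring.
rewrite FG hformC FG [F k h + _]addrC; congr (_ + _).
by apply: eq_bigr => w _; ring.
Qed.

Definition orth_pred (U : submod (regmod H)) : {pred regmod H} :=
  fun h => `[< forall v : regmod H, v \in U -> hform h v = 0 >].

(** By [hecke_ind] only the [T s] matter; they are self-adjoint and preserve [U]. *)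
Lemma orth_closed U : subsemimod_closed (orth_pred U).
Proof.
have add h k : h \in orth_pred U -> k \in orth_pred U -> h + k \in orth_pred U.
  move=> /asboolP ho /asboolP ko; apply/asboolP => v vU.
  by rewrite hformDl ho // ko // addr0.
split=> [|a h]; first split=> //.
  by apply/asboolP => v _; rewrite hform0l.
elim/hecke_ind: a h => [a b Pa Pb|z a Pa||s a sS Pa] h ho.
- by rewrite scalerDl; apply: add; [apply: Pa | apply: Pb].
- apply/asboolP => v vU; have /asboolP /(_ v vU) e := Pa h ho.
  have -> : (z *: a) *: h = z *: (a * (h : H)) :> H by rewrite scalerAl.
  by rewrite hformZl e mulr0.
- by rewrite scale1r.
- apply/asboolP => v vU; have /asboolP oh := Pa h ho.
  have -> : (T s * a) *: h = T s * (a * (h : H)) :> H by rewrite mulrA.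
  by rewrite hform_mulT //; apply: oh; exact: (@rpredZ _ _ U (T s) v vU).
Qed.

Definition orth (U : submod (regmod H)) : submod (regmod H) :=
  Submod (orth_closed U).

Lemma orthP (U : submod (regmod H)) (h : regmod H) :
  reflect (forall v : regmod H, v \in U -> hform h v = 0) (h \in orth U).
Proof. exact: asboolP. Qed.

End Coordinates.

(** * Orthogonal decomposition *)

Lemma row_anisotropic n (v : 'rV[ratfun]_n) : v *m v^T = 0 -> v = 0.
Proof.
move=> /matrixP /(_ 0 0); rewrite !mxE => e; apply/rowP => i; rewrite mxE.
apply: (ratfun_sqr_sum (x := fun i => v 0 i)); rewrite -[RHS]e.
by apply: eq_bigr => j _; rewrite mxE.
Qed.

Section Orthogonal.
Variables (W : finGroupType) (S : {set W}) (L : W -> nat) (H : hecke_datum S L).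

Local Notation n := #|W|.

(* the coordinates with respect to the basis t^-L(w) T_w, for which [hform] is the
   standard scalar product *)
Definition vec (h : H) : 'rV[ratfun]_n :=
  \row_i (val (hcoef h (enum_val i)) * val (tpow (L (enum_val i))%:Z)).

Lemma vecD h k : vec (h + k) = vec h + vec k.
Proof. by apply/rowP => i; rewrite !mxE hcoefD rmorphD mulrDl. Qed.

Lemma vecZ z h : vec (z *: h) = val z *: vec h.
Proof. by apply/rowP => i; rewrite !mxE hcoefZ rmorphM mulrA. Qed.

Lemma vecB h k : vec (h - k) = vec h - vec k.
Proof. by rewrite -scaleN1r vecD vecZ rmorphN1 scaleN1r. Qed.

Lemma vec0 : vec 0 = 0.
Proof. by rewrite -(scale0r 0) vecZ rmorph0 scale0r. Qed.

Lemma vec_sum (I : Type) (r : seq I) (F : I -> H) :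
  vec (\sum_(i <- r) F i) = \sum_(i <- r) vec (F i).
Proof.
elim: r => [|i r IHr]; first by rewrite !big_nil vec0.
by rewrite !big_cons vecD IHr.
Qed.

Lemma tpow_neq0 m : tpow m != 0.
Proof. by apply: contraTneq (tpow_unit m) => ->; rewrite unitr0. Qed.

Lemma vec_inj : injective vec.
Proof.
move=> h k e; apply: hcoef_inj => w; apply: val_inj.
have /rowP /(_ (enum_rank w)) := e; rewrite !mxE enum_rankK; apply: mulIf.
by apply: contra (tpow_neq0 (L w)) => /eqP e0; apply/eqP/val_inj.
Qed.

Lemma vec_form h k : vec h *m (vec k)^T = (val (hform h k))%:M.
Proof.
apply/matrixP => i j; rewrite !ord1 !mxE eqxx mulr1n rmorph_sum.
rewrite [RHS](reindex_onto (@enum_val W W) enum_rank) => [|w _]; last exact: enum_rankK.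
rewrite [RHS](eq_bigl predT) => [|l]; last by rewrite enum_valK eqxx.
apply: eq_bigr => l _; rewrite !mxE.
have -> : tpow (2 * (L (enum_val l))%:Z) =
    tpow (L (enum_val l))%:Z * tpow (L (enum_val l))%:Z.
  by rewrite -tpowD mulrDl mul1r.
by rewrite !rmorphM; ring.
Qed.

Lemma hform_eq0 (h : H) : hform h h = 0 -> h = 0.
Proof.
move=> e; apply: vec_inj; rewrite vec0; apply: row_anisotropic.
by rewrite vec_form e !rmorph0.
Qed.

(** The row space of [A] is the Q(t)-span of [U], so the rank of [A] is the dimension of that
    span. *)
Variant spans (U : submod (regmod H)) m (A : 'M[ratfun]_(m, n)) : Prop :=
  Spans of (forall i, exists2 v : regmod H, v \in U & row i A = vec v)
         & (forall v : regmod H, v \in U -> (vec v <= A)%MS).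

(** A matrix of maximal rank with rows from [U] works: appending one more vector of [U] cannot raise
    the rank. *)
Lemma spans_exists U : exists m (A : 'M_(m, n)), spans U A.
Proof.
pose P r := `[< exists m (A : 'M_(m, n)),
  (forall i, exists2 v : regmod H, v \in U & row i A = vec v) /\ \rank A = r >].
have [] := @ex_maxnP P n.
- by exists 0%N; apply/asboolP; exists 0%N, 0; split; [case|rewrite mxrank0].
- by move=> _ /asboolP [m [A [_ <-]]]; apply: rank_leq_col.
move=> _ /asboolP [m [A [rowA <-]]] max; exists m, A; split=> // v vU.
have le : (\rank (col_mx A (vec v)) <= \rank A)%N.
  apply: max; apply/asboolP; exists (m + 1)%N, (col_mx A (vec v)); split=> // i.
  case: (split_ordP i) => j ->; first by rewrite rowKu.
  by exists v => //; rewrite rowKd ord1 row_id.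
have eqA : (A :=: A + vec v)%MS.
  by apply/eqmxP; rewrite -(geq_leqif (mxrank_leqif_eq (addsmxSl _ _))) addsmxE.
by rewrite eqA addsmxSr.
Qed.

(** Here [d] is a common denominator of the entries of [y]; after scaling, the combination has
    coefficients in Z[t] and stays in [U]. *)
Lemma spans_comb U m (A : 'M_(m, n)) (y : 'rV_m) : spans U A ->
  exists2 d : laurent, d != 0 &
    exists2 v : regmod H, v \in U & val d *: (y *m A) = vec v.
Proof.
case=> rowA _.
have {rowA} /choice [v hv] i : exists v : regmod H, v \in U /\ row i A = vec v.
  by have [v vU ev] := rowA i; exists v.
have vU i := (hv i).1; have rowv i := (hv i).2.
have [d d0 [p e]] := frac_common_denom (fun i => y 0 i).
exists (laurent_poly d).
  by apply/eqP => /(congr1 val) /eqP; rewrite rmorph0 tofrac_eq0 (negPf d0).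
exists (\sum_i laurent_poly (p i) *: (v i : H)).
  apply: rpred_sum => i _; rewrite -[_ *: _]zscale_regular; exact: rpredZ.
rewrite vec_sum mulmx_sum_row scaler_sumr; apply: eq_bigr => i _.
by rewrite vecZ rowv scalerA; congr (_ *: _); exact: e.
Qed.

Lemma spans_mem U m (A : 'M_(m, n)) (h : H) : spans U A -> (vec h <= A)%MS ->
  exists2 d : laurent, d != 0 & (d *: h : regmod H) \in U.
Proof.
move=> sA /submxP [y ey]; have [d d0 [v vU e]] := spans_comb y sA.
by exists d => //; rewrite (_ : d *: h = v) //; apply: vec_inj; rewrite vecZ ey.
Qed.

Hypothesis std : standard_coxeter_system S L.

(** Over Q(t) the row space of [A] and the kernel of its transpose are complementary: anisotropy
    makes them meet trivially and their dimensions add up to [n]. The scalar [d] clears the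
    denominators of the component along [U]. *)
Lemma orth_decomposition (U : submod (regmod H)) (h : H) :
  exists2 d : laurent, d != 0 & exists2 v : regmod H, v \in U &
    (d *: h - v : regmod H) \in orth std U.
Proof.
have [m [A sA]] := spans_exists U.
have cap0 : (A :&: kermx A^T = 0)%MS.
  apply/eqP; rewrite -submx0; apply/rV_subP => v.
  (* A vector [x *m A] killed by the transpose of [A] has norm zero. *)
  rewrite sub_capmx => /andP [/submxP [x ->]] /sub_kermxP xA.
  rewrite submx0; apply/eqP/row_anisotropic.
  by rewrite trmx_mul mulmxA xA mul0mx.
have : (vec h <= A + kermx A^T)%MS.
  apply: submx_full; rewrite /row_full.
  have := mxrank_sum_cap A (kermx A^T); rewrite cap0 mxrank0 addn0 => ->.
  by rewrite mxrank_ker mxrank_tr subnKC // rank_leq_col.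
case/sub_addsmxP => -[x z] /= eh.
have [d d0 [v vU ev]] := spans_comb x sA; exists d => //; exists v => //.
apply/(orthP std) => v' v'U; case: sA => _ /(_ v' v'U) /submxP [y ey].
have /matrixP /(_ 0 0) := vec_form (d *: h - v) v'.
rewrite vecB vecZ eh -ev scalerDr addrC addKr ey trmx_mul -scalemxAl -mulmxA.
rewrite (mulmxA _ A^T) mulmx_ker mul0mx mulmx0 scaler0 !mxE eqxx mulr1n => e.
by apply/val_inj; rewrite rmorph0.
Qed.

End Orthogonal.

(** * Submodules of a localisation *)

(** Schur's argument: the kernel is a submodule and is not everything. *)
Lemma irreducible_injective (R : pzRingType) (E V : lmodType R)
    (f : {linear E -> V}) :
  irreducible E -> (exists x, f x <> 0) -> injective f.
Proof.
case=> _ irr [x fx].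
have clK : subsemimod_closed (fun x : E => f x == 0).
  split=> [|a y]; first split=> [|y z].
  - by change (f 0 == 0); rewrite raddf0.
  - by change (f y == 0 -> f z == 0 -> f (y + z) == 0);
      move=> /eqP ey /eqP ez; rewrite linearD ey ez addr0.
  - by change (f y == 0 -> f (a *: y) == 0); move=> /eqP ey; rewrite linearZ /= ey scaler0.
have [K0|KT] := irr (Submod clK); last by have /eqP := KT x.
move=> y z e; apply/eqP; rewrite -subr_eq0; apply/eqP/K0.
by change (f (y - z) == 0); rewrite linearB e subrr.
Qed.

Section Localisation.
Variables (Z : idomainType) (H : algType Z) (M : lmodType H).
Local Notation dv := (@denom_val Z).

Lemma locfrac0 a : locfrac (0 : M) a = 0.
Proof. by apply: locfrac_eq; rewrite !scaler0. Qed.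

Lemma loc_map_eq0 (N : lmodType H) (m : N) :
  loc_map m = 0 -> exists2 s : Z, s != 0 & s%:A *: m = 0.
Proof.
move=> /locfracP [s]; rewrite /= !scaler0 !scale1r => e.
by exists (dv s) => //; exact: denom_neq0.
Qed.

Lemma loc_mapE (m : M) a :
  loc_map m = (loc_map ((dv a)%:A : regmod H) : locring H) *: locfrac m a.
Proof.
rewrite [RHS]locscaleE; apply: locfrac_eq => /=.
by rewrite mul1r !scale1r.
Qed.

Lemma locfracE (m : M) a :
  locfrac m a = (locfrac (1 : regmod H) a : locring H) *: loc_map m.
Proof.
rewrite [RHS]locscaleE; apply: locfrac_eq => /=.
by rewrite mulr1 !scale1r.
Qed.

(** Denominators act invertibly on [locmod M], so submodules do not see them. *)
Lemma locfrac_mem (U : submod (locmod M)) (m : M) a :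
  (locfrac m a \in U) = (loc_map m \in U).
Proof.
by apply/idP/idP => h; [rewrite (loc_mapE m a) | rewrite (locfracE m a)]; apply: rpredZ.
Qed.

Lemma contractE (U : submod (locmod M)) (m : M) :
  (m \in contract U) = (loc_map m \in U).
Proof. by []. Qed.

Lemma loc_map_scale_mem (U : submod (locmod M)) (m : M) (d : Z) : d != 0 ->
  loc_map (d%:A *: m) \in U -> loc_map m \in U.
Proof.
move=> d0; rewrite -(locfrac_mem _ _ (Denom d0)).
suff -> : locfrac (d%:A *: m) (Denom d0) = loc_map m by [].
by apply: locfrac_eq; rewrite /= !scale1r.
Qed.

Definition loc_pred (C : submod M) : {pred locmod M} := fun x =>
  `[< exists2 m, m \in C & exists a, x = locfrac m a >].

Lemma loc_closed (C : submod M) : subsemimod_closed (loc_pred C).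
Proof.
split=> [|r x]; first split=> [|x y].
- by apply/asboolP; exists 0; [exact: rpred0 | exists (denom1 Z)].
- move=> /asboolP [m mC [a ->]] /asboolP [m' mC' [b ->]]; apply/asboolP.
  rewrite locfracD; eexists; last by eexists.
  by apply: rpredD; apply: rpredZ.
- move=> /asboolP [m mC [a ->]]; apply/asboolP.
  elim/locring_ind: r => h b; rewrite [_ *: _]locscaleE; eexists; last by eexists.
  exact: rpredZ.
Qed.

Definition loc_submod (C : submod M) : submod (locmod M) := Submod (loc_closed C).

Lemma loc_submodP (C : submod M) x :
  reflect (exists2 m, m \in C & exists a, x = locfrac m a) (x \in loc_submod C).
Proof. exact: asboolP. Qed.

Section Extend.
Variables (U : submod (locmod M)) (P : lmodType H).
Variable phi : {linear submodType (contract U) -> P}.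

Lemma loc_extend_subproof (u : submodType U) : (repr (val u)).1 \in contract U.
Proof.
rewrite contractE -(locfrac_mem _ _ (repr (val u)).2).
by rewrite /locfrac -surjective_pairing reprK; exact: valP.
Qed.

(** Extension of scalars of [phi]: every element of [U] is a fraction whose numerator lies in
    [contract U]. The chosen representative is immaterial by [loc_extendE]. *)
Definition loc_extend (u : submodType U) : locmod P :=
  locfrac (phi (SubmodElt (loc_extend_subproof u))) (repr (val u)).2.

Lemma loc_extendE (u : submodType U) (m : submodType (contract U)) a :
  val u = locfrac (val m) a -> loc_extend u = locfrac (phi m) a.
Proof.
move=> e; have [s] := locfrac_repr (val m) a; rewrite /loc_extend -e => es.
apply/locfracP; exists s; rewrite -!linearZ; congr (phi _).
by apply: val_inj; rewrite !linearZ.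
Qed.

Lemma loc_extend_linear : linear loc_extend.
Proof.
move=> r x y.
have rep (u : submodType U) : exists (m : submodType (contract U)) a,
      val u = locfrac (val m) a.
  exists (SubmodElt (loc_extend_subproof u)), (repr (val u)).2.
  by rewrite /locfrac /= -surjective_pairing reprK.
have [m [a ex]] := rep x; have [m' [b ey]] := rep y.
rewrite (loc_extendE ex) (loc_extendE ey).
elim/locring_ind: r => h c; rewrite [_ *: locfrac _ _]locscaleE locfracD.
rewrite -!linearZ -linearD; apply: loc_extendE.
by rewrite !linearD !linearZ /= ex ey [_ *: locfrac _ _]locscaleE locfracD.
Qed.

HB.instance Definition _ := GRing.isLinear.Build _ _ _ _ loc_extend loc_extend_linear.

End Extend.

(** A non-torsion value [phi m] survives in [locmod P], so the extension of [phi] is nonzero, hence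
    injective. *)
Lemma irreducible_occurs (U : submod (locmod M)) (P : lmodType H)
    (phi : {linear submodType (contract U) -> P}) :
  irreducible (submodType U) ->
  (exists m, forall s : Z, s != 0 -> s%:A *: phi m <> 0) ->
  occurs_in (submodType U) (locmod P).
Proof.
move=> irr [m phim]; exists (loc_extend phi : {linear _ -> _}).
apply: irreducible_injective => //; exists (SubmodElt (valP m : loc_map (val m) \in U)).
rewrite /= (loc_extendE phi (m := m) (a := denom1 Z)) // => e.
by have [s s0] := loc_map_eq0 (e : loc_map (phi m) = 0); apply: phim.
Qed.

End Localisation.

(** * Left cells *)

Lemma subquot_projP (R : pzRingType) (M : lmodType R) (U V : submod M)
    (u v : submodType U) :
  reflect (subquot_proj V u = subquot_proj V v) (val u - val v \in V).
Proof.
apply: (iffP idP) => [h|/eqP].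
  apply/eqP; rewrite quotmod_eq.
  by change (val (u - v) \in V); rewrite linearB.
rewrite quotmod_eq => h.
by rewrite -linearB.
Qed.

Lemma subquot_proj_scale_eq0 (R : pzRingType) (M : lmodType R) (U V : submod M)
    (a : R) (u : submodType U) : a *: subquot_proj V u = 0 -> a *: val u \in V.
Proof.
have <- : subquot_proj V (0 : submodType U) = 0.
  have e : subquot_proj V (0 : submodType U) + subquot_proj V 0 =
      subquot_proj V 0 :> subquot U V.
    by rewrite -[LHS]quotmod_projD addr0.
  by rewrite -[LHS](addrK (subquot_proj V 0 : subquot U V)) e subrr.
rewrite /subquot_proj -[LHS]quotmod_projZ => /subquot_projP.
by rewrite linearZ [val 0]linear0 subr0.
Qed.

(* Second isomorphism theorem: [phi] is the composite of [g], whose image lies in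
   U + X, with U + X -> (U + X) / (V + X) = U / V. *)
Lemma subquot_lift (R : pzRingType) (M N : lmodType R) (U V X : submod M)
    (g : {linear N -> M}) :
  (forall x, exists u : submodType U, g x - val u \in X) ->
  (forall u, u \in U -> u \in X -> u \in V) ->
  exists phi : {linear N -> subquot U V},
    forall x (u : submodType U), g x - val u \in X -> phi x = subquot_proj V u.
Proof.
move=> /choice [f fX] capV.
have indep x (u : submodType U) : g x - val u \in X ->
    subquot_proj V (f x) = subquot_proj V u.
  move=> uX; apply/subquot_projP/capV.
    by apply: rpredB; exact: valP.
  have -> : val (f x) - val u = (g x - val u) - (g x - val (f x)).
    by rewrite opprB [RHS]addrC addrA subrK.
  exact: rpredB.
have lin : linear (fun x => subquot_proj V (f x)).
  move=> a x y; transitivity (subquot_proj V (a *: f x + f y)); last first.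
    by rewrite /subquot_proj quotmod_projD quotmod_projZ.
  apply: indep.
  have -> : g (a *: x + y) - val (a *: f x + f y) =
      a *: (g x - val (f x)) + (g y - val (f y)).
    by rewrite !linearD !linearZ /= addrACA scalerBr scalerN.
  by apply: rpredD => //; apply: rpredZ.
pose phi : {linear N -> subquot U V} :=
  HB.pack (fun x => subquot_proj V (f x)) (GRing.isLinear.Build _ _ _ _ _ lin).
by exists phi.
Qed.

(** * Coordinates in the basis [kl_], and irreducibles in left cell modules *)

Section KLBasis.
Variables (W : finGroupType) (S : {set W}) (L : W -> nat) (H : hecke_datum S L).
Local Notation T := (T_ H).
Local Notation c := (kl_ H).

(** Unitriangularity up to units: for [y] of maximal length with [a y != 0], only [c y] contributes
    to the coefficient of [T y]. *)
Lemma kl_free (a : W -> laurent) : \sum_w a w *: c w = 0 -> forall w, a w = 0.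
Proof.
move=> e w; apply/eqP; apply: contraT => aw.
have [y ay max] := arg_maxnP (fun w => word_length S w) (P := fun w => a w != 0) aw.
have := congr1 (fun h => hcoef h y) e; rewrite hcoef0 hcoef_sum (bigD1 y) //=.
rewrite big1 ?addr0 => [|x xy].
  have [p ->] := kl_expand_lead H y; rewrite hcoefZ hcoefD hcoefZ hcoefT eqxx mulr1.
  rewrite hcoef_sum big1 ?addr0 => [|x].
    by move/eqP; rewrite mulf_eq0 (negPf ay) (negPf (tpow_neq0 _)).
  move=> /bruhat_lt_length lt; rewrite hcoefZ hcoefT.
  by case: eqP lt => [->|]; rewrite ?ltnn ?mulr0.
rewrite hcoefZ; have [->|ax] := eqVneq (a x) 0; first by rewrite mul0r.
have [p ->] := kl_expand_lead H x; rewrite hcoefD hcoefZ hcoefT.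
rewrite eq_sym (negPf xy) mulr0 add0r hcoef_sum big1 ?mulr0 // => z.
move=> /bruhat_lt_length lt; rewrite hcoefZ hcoefT; case: eqP => [yz|]; last first.
  by rewrite mulr0.
by have := leq_trans lt (max x ax); rewrite -yz ltnn.
Qed.

Definition kcoef (h : H) : W -> laurent :=
  sval (cid (elimT (kl_spanP setT h) (kl_span_all h))).

Lemma kcoefE h : h = \sum_w kcoef h w *: c w.
Proof.
rewrite {1}(svalP (cid (elimT (kl_spanP setT h) (kl_span_all h)))).
by apply: eq_bigl => w; rewrite inE.
Qed.

Lemma kcoefP h (a : W -> laurent) : h = \sum_w a w *: c w -> kcoef h =1 a.
Proof.
move=> e w; apply/eqP; rewrite -subr_eq0; apply/eqP.
apply: (kl_free (a := fun w => kcoef h w - a w)).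
rewrite (eq_bigr (fun w => kcoef h w *: c w - a w *: c w)) => [|x _].
  by rewrite sumrB -e -kcoefE subrr.
by rewrite scalerBl.
Qed.

Lemma kcoefB h k w : kcoef (h - k) w = kcoef h w - kcoef k w.
Proof.
apply: (kcoefP (a := fun w => kcoef h w - kcoef k w)).
rewrite {1}(kcoefE h) {1}(kcoefE k) -sumrB.
by apply: eq_bigr => x _; rewrite scalerBl.
Qed.

Lemma kcoefZ z h w : kcoef (z *: h) w = z * kcoef h w.
Proof.
apply: (kcoefP (a := fun w => z * kcoef h w)).
by rewrite {1}(kcoefE h) scaler_sumr; apply: eq_bigr => x _; rewrite scalerA.
Qed.

Lemma kl_span_kcoef (A : {set W}) (h : H) :
  ((h : regmod H) \in kl_span A) <-> (forall w, kcoef h w != 0 -> w \in A).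
Proof.
split=> [/kl_spanP [a e] w|hA].
  apply: contraR => wA.
  have -> : kcoef h w = if w \in A then a w else 0; last by rewrite (negPf wA).
  apply: (kcoefP (a := fun w => if w \in A then a w else 0)).
  by rewrite e big_mkcond; apply: eq_bigr => x _; case: ifP; rewrite ?scale0r.
apply/(kl_spanP A h); exists (kcoef h); rewrite [RHS]big_mkcond {1}(kcoefE h).
apply: eq_bigr => w _; case: ifP => // /negbT wA.
have [->|/hA] := eqVneq (kcoef h w) 0; first by rewrite scale0r.
by rewrite (negPf wA).
Qed.

Lemma kl_span_scale (A : {set W}) z (h : H) : z != 0 ->
  (z *: h : regmod H) \in kl_span A -> (h : regmod H) \in kl_span A.
Proof.
move=> z0 zA; have hA := (kl_span_kcoef A (z *: h)).1 zA.
apply/(kl_span_kcoef A h) => w hw; apply: (hA w).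
rewrite (kcoefZ z h); exact: mulf_neq0 z0 hw.
Qed.

Lemma kcoef_restrict (P : pred W) (h : H) w :
  kcoef (\sum_(z | P z) kcoef h z *: c z) w = if P w then kcoef h w else 0.
Proof.
apply: (kcoefP (a := fun w => if P w then kcoef h w else 0)); rewrite big_mkcond.
by apply: eq_bigr => z _; case: ifP; rewrite ?scale0r.
Qed.

Lemma leL_refl w : leL H w w.
Proof. exact: connect0. Qed.

Lemma leL_trans : transitive (leL H).
Proof. exact: connect_trans. Qed.

Hypothesis std : standard_coxeter_system S L.
Local Notation genS := (standard_generates std).

(* If A is a leL-closed set of least size with contract U inside kl_span A, and
   omega is a maximal left cell of A, then contract U maps nontrivially to the
   quotient of kl_span A by the span of A minus omega. *)
Lemma irreducible_occurs_in_cell (M : submod (regmod H))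
    (U : submod (locmod (submodType M))) :
  irreducible (submodType U) ->
  exists omega : left_cell H, occurs_in (submodType U) (locmod (cell_module std omega)).
Proof.
move=> irr; pose C := contract U.
pose P (A : {set W}) := `[< leL_closed H A /\
  forall m, m \in C -> val m \in @kl_span _ _ _ H A >].
have PT : P setT.
  by apply/asboolP; split=> [y w _|m _]; [rewrite !inE | exact: kl_span_all].
have [A /asboolP [clA CA] minA] := arg_minnP (fun A : {set W} => #|A|) PT.
have [y0 y0A] : exists y, y \in A.
  apply/set0Pn; apply/eqP => A0; case: irr => -[x x0] _; apply: x0.
  apply: val_inj; rewrite linear0; elim/locfrac_ind: (val x) (valP x) => m a.
  rewrite locfrac_mem -contractE => /CA; rewrite A0 => /kl_spanP [b].
  rewrite big_set0 => m0; suff -> : m = 0 by exact: locfrac0.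
  exact: val_inj.
(* An element with the largest lower set is maximal in [A] for the preorder. *)
have [y yA maxy] := arg_maxnP (fun y => #|[set z | leL H z y]|) y0A.
have {}maxy z : z \in A -> leL H y z -> leL H z y.
  move=> zA yz.
  have sub : [set x | leL H x y] \subset [set x | leL H x z].
    by apply/subsetP => x; rewrite !inE => xy; apply: leL_trans yz.
  have /eqP e : [set x | leL H x y] == [set x | leL H x z] by rewrite eqEcard sub; exact: maxy.
  have : z \in [set x | leL H x z] by rewrite inE leL_refl.
  by rewrite -e inE.
have cellP : [set z in [set: W] | simL H y z] \in left_cells H.
  by apply: imset_f; rewrite inE.
pose omega : left_cell H := exist (fun o : {set W} => o \in left_cells H) _ cellP.
exists omega.
have inomega w : (w \in val omega) = simL H y w by rewrite !inE.
(* By maximality of [y], the elements of [A] above [y] form part of its cell [omega]. *)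
pose A' := A :\: [set z | leL H y z].
have clA' : leL_closed H A'.
  move=> z w zw; rewrite !inE => /andP [nyw wA]; rewrite (clA _ _ zw wA) andbT.
  by apply: contra nyw => yz; apply: leL_trans zw.
pose X : submod (regmod H) := Submod (kl_span_closed genS clA').
have ylt z : z \in cell_lt omega -> ~~ leL H y z.
  rewrite inE => /existsP [w]; rewrite inomega => /andP [/andP [yw wy] /andP [zw nwz]].
  by apply: contra nwz; apply: leL_trans.
(* The part of [m] supported above [y] represents its image in the cell module; the rest lies in
   [X]. *)
have h'le (m : submodType C) :
    (\sum_(z | leL H y z) kcoef (val (val m)) z *: c z : regmod H)
      \in cell_le_submod std omega.
  have /kl_span_kcoef mA := CA _ (valP m).
  apply/kl_span_kcoef => w; rewrite kcoef_restrict; case: ifP => [yw /mA wA|]; last first.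
    by rewrite eqxx.
  by rewrite inE; apply/existsP; exists y; rewrite inomega /simL leL_refl maxy.
have h'X (m : submodType C) : val (val m) - val (SubmodElt (h'le m)) \in X.
  have /kl_span_kcoef mA := CA _ (valP m).
  apply/kl_span_kcoef => w /=; rewrite kcoefB kcoef_restrict.
  by case: ifP => [|/negbT yw]; rewrite ?subrr ?eqxx // subr0 => /mA wA; rewrite !inE yw.
have [||phi hphi] := @subquot_lift _ _ (submodType C) (cell_le_submod std omega)
    (cell_lt_submod std omega) X (val \o val).
- by move=> m; exists (SubmodElt (h'le m)); exact: h'X.
(* A coordinate below [omega] but not above [y] is strictly below [omega]. *)
- move=> u /kl_span_kcoef ule /kl_span_kcoef uX; apply/kl_span_kcoef => w uw.
  have := ule w uw; have := uX w uw; rewrite !inE => /andP [nyw wA] /existsP [x].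
  rewrite inomega => /andP [/andP [yx xy] wx]; apply/existsP; exists x.
  rewrite inomega /simL yx xy /ltL wx /=.
  by apply: contra nyw; apply: leL_trans.
apply: (irreducible_occurs (phi := phi) irr).
(* Otherwise the smaller closed set [A'] would contradict the choice of [A]. *)
have [m mC mA'] : exists2 m, m \in C & val m \notin kl_span A'.
  apply: contrapT => nm.
  have : (#|A| <= #|A'|)%N.
    apply: minA; apply/asboolP; split=> // m mC; apply: contrapT => /negP h.
    by apply: nm; exists m.
  apply/negP; rewrite -ltnNge; apply: proper_card; apply/properP; split.
    exact: subsetDl.
  by exists y => //; rewrite !inE leL_refl.
exists (SubmodElt mC) => s s0; rewrite (hphi _ _ (h'X _)) => e.
have {e} := subquot_proj_scale_eq0 e; rewrite zscale_regular => e.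
have {e} e := kl_span_scale s0 e; move/negP: mA'; apply.
have /kl_span_kcoef mA := CA _ mC.
apply/kl_span_kcoef => w mw; rewrite !inE mA // andbT; apply/negP => yw.
(* If the image of [m] were torsion, its part above [y] would be supported strictly below [omega],
   where nothing is above [y]. *)
suff /ylt : w \in cell_lt omega by rewrite yw.
by apply: (iffLR (kl_span_kcoef _ _) e); rewrite kcoef_restrict yw.
Qed.
End KLBasis.

(** * Semisimplicity *)

Section Image.
Variables (R : pzRingType) (M N : lmodType R) (f : {linear N -> M}) (C : submod N).

Definition image_pred : {pred M} := fun x => `[< exists2 y, y \in C & f y = x >].

Lemma image_closed : subsemimod_closed image_pred.
Proof.
split=> [|a x]; first split=> [|x y].
- by apply/asboolP; exists 0; rewrite ?linear0 ?rpred0.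
- move=> /asboolP [u uC <-] /asboolP [v vC <-]; apply/asboolP.
  by exists (u + v); rewrite ?linearD ?rpredD.
- move=> /asboolP [u uC <-]; apply/asboolP.
  by exists (a *: u); rewrite ?linearZ ?rpredZ.
Qed.

Definition image_submod : submod M := Submod image_closed.

Lemma image_submodP x : reflect (exists2 y, y \in C & f y = x) (x \in image_submod).
Proof. exact: asboolP. Qed.

Lemma image_mem y : injective f -> (f y \in image_submod) = (y \in C).
Proof.
move=> finj; apply/image_submodP/idP => [[z zC /finj <-] //|yC].
by exists y.
Qed.

End Image.

Section Semisimple.
Variables (W : finGroupType) (S : {set W}) (L : W -> nat) (H : hecke_datum S L).
Variable std : standard_coxeter_system S L.
Variable M0 : submod (regmod H).
Local Notation M := (submodType M0).
Local Notation emb := (val : {linear M -> regmod H}).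
Local Notation lattice U := (image_submod emb (contract U)).

(** [lattice U] is the integral part of [U] placed inside H, where ranks and orthogonal complements
    are available. *)
Lemma lattice_mem (U : submod (locmod M)) (m : M) :
  (val m \in lattice U) = (loc_map m \in U).
Proof. by rewrite (image_mem _ _ (f := emb) val_inj) contractE. Qed.

(** A nonzero submodule of [U] has the same rank by minimality, hence the same span over Q(t), and
    clearing denominators shows that it is all of [U]. *)
Lemma minimal_rank_irreducible (U : submod (locmod M)) m (A : 'M[ratfun]_(m, #|W|)) :
  (exists2 u, u \in U & u <> 0) -> spans (lattice U) A ->
  (forall (U' : submod (locmod M)) m' (A' : 'M_(m', #|W|)), {subset U' <= U} ->
     (exists2 u, u \in U' & u <> 0) -> spans (lattice U') A' ->
     (\rank A <= \rank A')%N) ->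
  irreducible (submodType U).
Proof.
move=> [u0 u0U u00] sA min; split.
  by exists (SubmodElt u0U) => e; apply: u00; rewrite -[u0]/(val (SubmodElt u0U)) e linear0.
move=> U1; have [[y [yU1 y0]]|z] := pselect (exists y, y \in U1 /\ y <> 0); last first.
  by left=> x xU1; apply: contrapT => x0; apply: z; exists x.
right=> x; pose U' := image_submod (val : {linear submodType U -> locmod M}) U1.
have U'U : {subset U' <= U} by move=> _ /image_submodP [w _ <-]; exact: valP.
have [m' [A' sA']] := spans_exists (lattice U').
have le : (\rank A <= \rank A')%N.
  apply: min U'U _ sA'; exists (val y); first by apply/image_submodP; exists y.
  by move=> e; apply: y0; apply: val_inj; rewrite linear0.
have A'A : (A' <= A)%MS.
  apply/row_subP => i; case: sA' => /(_ i) [v vU' ->] _.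
  case: sA => _; apply; case/image_submodP: vU' => w wU' <-.
  by rewrite lattice_mem; apply: U'U.
have AA' : (A <= A')%MS by rewrite -(geq_leqif (mxrank_leqif_sup A'A)).
suff : val x \in U' by rewrite (image_mem _ _ (f := val) val_inj).
elim/locfrac_ind: (val x) (valP x) => w a; rewrite !locfrac_mem => wU.
have wA : (vec (val w) <= A')%MS.
  by apply: submx_trans AA'; case: sA => _; apply; rewrite lattice_mem.
have [d d0] := spans_mem sA' wA; rewrite -zscale_regular -linearZ lattice_mem.
exact: loc_map_scale_mem.
Qed.

(** If [V] were proper, its orthogonal complement would be nonzero and meet [V] trivially. A
    submodule of least rank with these two properties is irreducible, so it lies in [V], which is
    absurd. *)
Lemma locmod_semisimple (V : submod (locmod M)) :
  (forall U : submod (locmod M), irreducible (submodType U) -> {subset U <= V}) ->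
  forall x, x \in V.
Proof.
move=> irrV; apply: locfrac_ind => m a; rewrite locfrac_mem.
apply: contrapT => /negP mV.
pose P r := `[< exists U : submod (locmod M), [/\ exists2 u, u \in U & u <> 0,
  forall u, u \in U -> u \in V -> u = 0
  & exists m (A : 'M_(m, #|W|)), spans (lattice U) A /\ \rank A = r] >].
have : exists r, P r.
  pose O := orth std (lattice V); pose U := loc_submod (preim_submod emb O).
  have [n [A sA]] := spans_exists (lattice U).
  exists (\rank A); apply/asboolP; exists U; split; last by exists n, A.
    (* The witness is the orthogonal component of a multiple of [m]; were it zero, [m] would lie in
       [V]. *)
    have [d d0 [v vV dO]] := orth_decomposition std (lattice V) (val m).
    have /image_submodP [v' v'V ev] := vV.
    exists (loc_map (d%:A *: m - v')).
      apply/loc_submodP; exists (d%:A *: m - v'); last by exists (denom1 _).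
      change (emb (d%:A *: m - v') \in O).
      by rewrite linearB ev linearZ /= zscale_regular.
    move=> /loc_map_eq0 [s s0] /(congr1 val); rewrite linear0 linearZ /= zscale_regular.
    move=> /hecke_eq0 [/eqP|e]; first by rewrite (negPf s0).
    move/negP: mV; apply; apply: (loc_map_scale_mem d0).
    have /eqP : d%:A *: m - v' = 0 by apply: val_inj; rewrite linear0; exact: e.
    by rewrite -contractE subr_eq0 => /eqP ->.
  (* An element of [V] orthogonal to [V] has norm zero. *)
  move=> _ /loc_submodP [w wO [b ->]]; rewrite locfrac_mem -lattice_mem => wV.
  have /orthP /(_ _ wV) /hform_eq0 w0 : val w \in O by exact: wO.
  have -> : w = 0 by apply: val_inj; rewrite linear0.
  exact: locfrac0.
move=> /ex_minnP [_ /asboolP [U [Unz UV [n [A [sA <-]]]]] min].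
have irr : irreducible (submodType U).
  apply: (minimal_rank_irreducible Unz sA) => U' n' A' U'U U'nz sA'.
  apply: min; apply/asboolP; exists U'; split=> //; last by exists n', A'.
  by move=> u uU'; apply/UV/U'U.
by have [u uU u0] := Unz; apply: u0; apply: UV => //; exact: irrV uU.
Qed.

(** Every irreducible submodule occurs in some cell module, so the bound on [ht] admits all of them
    into the sum. *)
Lemma filt_full (ht : left_cell H -> int) h :
  (forall omega, ht omega < - h) -> forall m : M, m \in filt std ht M h.
Proof.
move=> lth m; rewrite contractE; apply/asboolP => V hV.
apply: locmod_semisimple => U irr; apply: hV; split=> //.
have [omega occ] := irreducible_occurs_in_cell std irr.
by exists (ht omega) => //; exists omega.
Qed.

End Semisimple.

(** * Invariant vectors *)

Section Parabolic.
Variables (W : finGroupType) (S : {set W}) (L : W -> nat) (H : hecke_datum S L).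
Variables (std : standard_coxeter_system S L) (J : {set W}).
Hypothesis J_sub : J \subset S.
Local Notation T := (T_ H).
Local Notation q w := (tpow (2 * (L w)%:Z)).

Let coxS : coxeter_system S. Proof. by case: std. Qed.
Let weightL : weight_function S L. Proof. by case: std. Qed.

(** The coefficients of [x_ H J] at [w] and [s * w] agree, so both cases of [hcoef_mulT] multiply by
    [q s]. *)
Lemma T_mul_x s : s \in J -> T s * x_ H J = q s *: x_ H J.
Proof.
move=> sJ; have sS := subsetP J_sub s sJ.
have xE w : hcoef (x_ H J) w = (w \in <<J>>%g)%:R.
  rewrite hcoef_sum; under eq_bigr => x _ do rewrite hcoefT.
  have [wJ|wJ] := boolP (w \in _).
    by rewrite (bigD1 w) //= eqxx big1 ?addr0 // => x /andP [_ /negPf]; rewrite eq_sym => ->.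
  by rewrite big1 // => x xJ; case: eqP => // wx; rewrite wx xJ in wJ.
apply: hcoef_inj => w; rewrite hcoefZ (hcoef_mulT std) // !xE (groupMl _ (mem_gen sJ)).
by case: ifP => _ //; rewrite mulrBl mul1r addrC subrK.
Qed.

Variable E : lmodType H.
Variable v : E.
Hypothesis v_inv : forall s, s \in J -> T s *: v = (q s)%:A *: v.

(** The induction runs over arbitrary words in [J], so no reduced expression inside [J] is required;
    the price is the descent case. *)
Lemma parabolic_T w : w \in <<J>>%g -> T w *: v = (q w)%:A *: v.
Proof.
case/gen_prodgP => n [u uJ ->]; elim: n u uJ => [|n IHn] u uJ.
  rewrite big_ord0 hecke_T1 !scale1r.
  have -> : L 1%g = 0%N.
    have := weightL (x := 1%g) (y := 1%g); rewrite !mulg1 word_length1; last by case: coxS.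
    by move=> /(_ erefl); lia.
  by rewrite mulr0 /tpow expr0z !scale1r.
rewrite big_ord_recl; set w' := (\prod_(i < n) _)%g; set s := u ord0.
have {IHn} IH : T w' *: v = (q w')%:A *: v by apply: IHn => i; apply: uJ.
have sJ : s \in J by exact: uJ.
have sS := subsetP J_sub s sJ.
have Ts : (T s * T w') *: v = (q s * q w')%:A *: v.
  by rewrite -scalerA IH -zscaleH v_inv // zscaleA mulrC.
have [up|] := boolP (bruhat_lt S w' (s * w')%g).
  by rewrite -hecke_mul_up // Ts (weight_mul_up coxS weightL sS up) PoszD mulrDr tpowD.
rewrite -(bruhat_lt_mulN coxS) // => dn.
have Lw' : L w' = (L s + L (s * w')%g)%N.
  by rewrite -(weight_mul_up coxS weightL sS) (coxeter_mulKg coxS) ?(coxeter_mulKg coxS).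
have qw' : q w' = q s * q (s * w')%g by rewrite Lw' PoszD mulrDr tpowD.
(* On a descent the quadratic rule is solved for [T (s * w') *: v], and the unit [q s] is then
   cancelled. *)
have : (q s)%:A *: (T (s * w')%g *: v) + ((q s - 1) * q w')%:A *: v =
    (q s * q w')%:A *: v.
  rewrite -Ts hecke_mul_down // scalerDl -(zscaleA _ _ v) -IH.
  by congr (_ + _); rewrite scalerA mulr_algl.
move=> /(canRL (addrK _)); rewrite -scalerBl -scalerBl.
have -> : q s * q w' - (q s - 1) * q w' = q s * q (s * w')%g by rewrite -qw'; ring.
rewrite -(zscaleA _ _ v) => /(congr1 (fun x => (tpow (- (2 * (L s)%:Z)))%:A *: x)).
have can (x : E) : (tpow (- (2 * (L s)%:Z)))%:A *: ((q s)%:A *: x) = x.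
  by rewrite zscaleA -tpowD addNr /tpow expr0z !scale1r.
by rewrite !can.
Qed.

Lemma x_scale : x_ H J *: v = (\sum_(w in <<J>>%g) q w)%:A *: v.
Proof.
by rewrite !scaler_suml; apply: eq_bigr => w wJ; exact: parabolic_T.
Qed.

Hypothesis tfE : torsion_free E.

Lemma Hx_hom : exists s : {linear Hx H J -> E},
  forall (y : Hx H J) (a : H), submod_val y = a * x_ H J :> H -> s y = a *: v.
Proof.
have indep (a b : H) : a * x_ H J = b * x_ H J -> a *: v = b *: v.
  move=> e; apply/eqP; rewrite -subr_eq0 -scalerBl; apply/eqP.
  (* The Poincare polynomial times [(a - b) *: v] is [((a - b) * x_ H J) *: v], which vanishes. *)
  have [|P0|//] := tfE (a := \sum_(w in <<J>>%g) q w) (m := (a - b) *: v).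
    by rewrite zscaleH -x_scale scalerA mulrBl e subrr scale0r.
  have := @tpow_sum_neq0 W (fun w => w \in <<J>>%g) (fun w => (2 * L w)%N) 1%g (group1 _).
  by case/eqP; rewrite -[RHS]P0; apply: eq_bigr => w _; rewrite PoszM.
have /choice [f hf] : forall y : Hx H J, exists a : H, submod_val y = a * x_ H J :> H.
  by move=> y; have /asboolP [a ea] := submod_valP y; exists a; exact: ea.
have lin : linear (fun y => f y *: v).
  move=> a x y; rewrite scalerA -scalerDl; apply: indep.
  rewrite -hf mulrDl -mulrA -!hf.
  exact: (linearP (val : {linear submodType _ -> regmod H}) a x y).
pose s : {linear Hx H J -> E} :=
  HB.pack (fun y => f y *: v) (GRing.isLinear.Build _ _ _ _ _ lin).
by exists s => y a e; apply: indep; rewrite -hf.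
Qed.

End Parabolic.

(** * Splitting *)

Section Split.
Variables (W : finGroupType) (S : {set W}) (L : W -> nat) (H : hecke_datum S L).
Variables Y Z : lmodType H.

Lemma ext_equiv_sym (xi xi' : extension Y Z) : ext_equiv xi xi' -> ext_equiv xi' xi.
Proof.
case=> phi [[psi phiK psiK] inj proj].
have lin : linear psi.
  move=> a x y; apply: (can_inj phiK).
  by rewrite psiK linearD linearZ /= !psiK.
pose psi' : {linear ext_mod xi' -> ext_mod xi} :=
  HB.pack psi (GRing.isLinear.Build _ _ _ _ _ lin).
exists psi'; split=> [|z|e]; first by exists phi.
  by rewrite -inj /= phiK.
by rewrite -[e in RHS]psiK proj.
Qed.

Lemma ext_equiv_trans (xi1 xi2 xi3 : extension Y Z) :
  ext_equiv xi1 xi2 -> ext_equiv xi2 xi3 -> ext_equiv xi1 xi3.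
Proof.
case=> phi [bphi inj proj] [psi [bpsi inj' proj']].
exists (psi \o phi : {linear _ -> _}); split=> [|z|e] /=.
- exact: bij_comp.
- by rewrite inj inj'.
- by rewrite proj' proj.
Qed.

(** The isomorphism sends [(z, y)] to [ext_inj xi z + s y]; it is onto because
    [e - s (ext_proj xi e)] lies in the kernel of the projection. *)
Lemma ext_split (xi : extension Y Z) (s : {linear Y -> ext_mod xi}) :
  short_exact (ext_inj xi) (ext_proj xi) -> (forall y, ext_proj xi (s y) = y) ->
  ext_equiv (Extension (@split_inj _ _ _ H Y Z) (@split_proj _ _ _ H Y Z)) xi.
Proof.
case=> _ _ inj ker _ sK.
have kerE z : ext_proj xi (ext_inj xi z) = 0 by apply/ker => //; exists z.
have lin : linear (fun e : Z * Y => ext_inj xi e.1 + s e.2).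
  by move=> a x y; rewrite !linearD !linearZ /= addrACA scalerDr.
pose phi : {linear (Z * Y)%type -> ext_mod xi} :=
  HB.pack (fun e : Z * Y => ext_inj xi e.1 + s e.2) (GRing.isLinear.Build _ _ _ _ _ lin).
exists phi; split=> [|z|e] /=; last 2 first.
- by rewrite linear0 addr0.
- by rewrite linearD /= kerE add0r sK.
have phi_inj : injective phi.
  move=> [z y] [z' y'] /= e.
  have ey : y = y'.
    by have := congr1 (ext_proj xi) e; rewrite !linearD /= !kerE !add0r !sK.
  by rewrite ey in e *; congr pair; apply: inj => //; apply: addIr e.
have /choice [psi psiK] e : exists x, phi x = e.
  have /(ker _ I) [z _ ez] : ext_proj xi (e - s (ext_proj xi e)) = 0.
    by rewrite linearB /= sK subrr.
  by exists (z, ext_proj xi e); rewrite /= ez subrK.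
by exists psi => // x; apply: phi_inj; rewrite psiK.
Qed.

End Split.

Theorem theorem2p1p6 (W : finGroupType) (S : {set W}) (L : W -> nat)
    (std : standard_coxeter_system S L) (H : hecke_datum S L)
    (ht : left_cell H -> int) (ht_height : height_function ht)
    (J : {set W}) (J_sub : J \subset S) (omega : left_cell H) :
  forall C : extension (Hx H J) (cell_module std omega) -> Prop,
    Ext1 std ht (Hx H J) (cell_module std omega) C ->
    C = Ext1_zero std ht (Hx H J) (cell_module std omega).
Proof.
move=> C [xi [[[_ [_ tfE _] _] exact_xi _] inv_xi] ->].
(* Equivalent extensions have the same class as a subset of [extension]. *)
suff eq0 : ext_equiv (Extension (@split_inj _ _ _ H _ _) (@split_proj _ _ _ H _ _)) xi.
  apply/funext => xi'; apply/propext; split=> -[? e]; split=> //.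
    exact: ext_equiv_trans e.
  by apply: ext_equiv_trans e; apply: ext_equiv_sym.
have xJ_mem : x_ H J \in Submod (ideal_closed (x_ H J)).
  by apply/asboolP; exists 1; rewrite scale1r.
pose xJ : Hx H J := SubmodElt xJ_mem.
(* At index 0 the filtration keeps all negative heights, so [xJ] belongs to that term and can be
   lifted. *)
have [_ _ _ _ lift] := inv_xi 0 J J_sub.
have [|v [_ v_inv] ev] := lift xJ.
  split=> [|s sJ].
    by apply: filt_full => o; rewrite oppr0; case: ht_height.
  apply: val_inj; rewrite !linearZ /= [RHS]zscale_regular.
  exact: (T_mul_x H std J_sub sJ).
have [s sP] := Hx_hom std J_sub v_inv tfE.
apply: (ext_split (s := s)) => // y.
have /asboolP [a ea] := submod_valP y.
by rewrite (sP y a ea) linearZ /= ev; apply: val_inj.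
Qed.
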